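(* Let $t>0$ and write $\theta_j'(u,t)=\frac{\partial \theta_j}{\partial t}(u,t)$. For $|\operatorname{Im} u|<\frac12\pi t$, $$-\frac{\theta_3'(u,t)}{\theta_3(u,t)}+\frac{\theta_4'(0,t)}{\theta_4(0,t)}=\sum_{k\ge 0}\frac{\pi^2(2k+1)\coth\left((k+\frac12)\pi^2 t\right)\cos^2(\pi u)}{\sinh^2\left((k+\frac12)\pi^2 t\right)+\cos^2(\pi u)}=2\sum_{k\ge 0}\frac{\pi^2(2k+1)\coth\left((k+\frac12)\pi^2 t\right)\cos^2(\pi u)}{\cosh\left((2k+1)\pi^2 t\right)+\cos(2\pi u)},$$ $$-\frac{\theta_4'(u,t)}{\theta_4(u,t)}+\frac{\theta_4'(0,t)}{\theta_4(0,t)}=\sum_{k\ge 0}\frac{\pi^2(2k+1)\coth\left((k+\frac12)\pi^2 t\right)\sin^2(\pi u)}{\sinh^2\left((k+\frac12)\pi^2 t\right)+\sin^2(\pi u)}=2\sum_{k\ge 0}\frac{\pi^2(2k+1)\coth\left((k+\frac12)\pi^2 t\right)\sin^2(\pi u)}{\cosh\left((2k+1)\pi^2 t\right)-\cos(2\pi u)}.$$ For $|\operatorname{Im} u|<\pi t$ (and, in each formula, $\theta_j(u,t)\neq 0$), $$-\frac{\theta_1'(u,t)}{\theta_1(u,t)}+\frac{\frac{\partial^2\theta_1}{\partial t\,\partial u}(0,t)}{\frac{\partial\theta_1}{\partial u}(0,t)}=\sum_{k\ge 1}\frac{2k\pi^2\coth(k\pi^2 t)\sin^2(\pi u)}{\sinh^2(k\pi^2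 t)+\sin^2(\pi u)}=2\sum_{k\ge 1}\frac{2k\pi^2\coth(k\pi^2 t)\sin^2(\pi u)}{\cosh(2k\pi^2 t)-\cos(2\pi u)},$$ $$-\frac{\theta_2'(u,t)}{\theta_2(u,t)}+\frac{\theta_2'(0,t)}{\theta_2(0,t)}=\sum_{k\ge 1}\frac{2k\pi^2\coth(k\pi^2 t)\cos^2(\pi u)}{\sinh^2(k\pi^2 t)+\cos^2(\pi u)}=2\sum_{k\ge 1}\frac{2k\pi^2\coth(k\pi^2 t)\cos^2(\pi u)}{\cosh(2k\pi^2 t)+\cos(2\pi u)}.$$
   Context: For $t>0$ put $\tau=i\pi t$ and $q=e^{i\pi\tau}=e^{-\pi^2 t}$. The Jacobi theta functions, as functions of $u\in\mathbb{C}$ and $t>0$, are $$\theta_1(u,t)=2\sum_{n\ge0}(-1)^n q^{(n+1/2)^2}\sin((2n+1)\pi u),\qquad \theta_2(u,t)=2\sum_{n\ge0}q^{(n+1/2)^2}\cos((2n+1)\pi u),$$ $$\theta_3(u,t)=1+2\sum_{n\ge1}q^{n^2}\cos(2n\pi u),\qquad \theta_4(u,t)=1+2\sum_{n\ge1}(-1)^nq^{n^2}\cos(2n\pi u).$$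
   Formalization: In the θ₂ formula the constant θ₂'(0,t)/θ₂(0,t) is replaced by (∂²θ₁/∂t∂u)(0,t)/(∂θ₁/∂u)(0,t), since as printed the formula fails (at u=0 the left side is 0 but the series is positive). *)

(* Defs.v *)
From Stdlib Require Import Reals.
From Coquelicot Require Import Coquelicot.
Local Open Scope R_scope.

Definition coth (x : R) : R := cosh x / sinh x.

Definition Cexp (z : C) : C := (exp (Re z) * cos (Im z), exp (Re z) * sin (Im z)).
Definition Ccos (z : C) : C := ((Cexp (Ci * z) + Cexp (- (Ci * z))) / 2)%C.
Definition Csin (z : C) : C := ((Cexp (Ci * z) - Cexp (- (Ci * z))) / (2 * Ci))%C.

(* Coquelicot's total operators [Series] and [Derive] are real-valued, so their
   complex-valued versions are taken componentwise, with the usual junk-value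
   caveat.  [CSeries_unique] and [CDerive_unique] below tie them to the
   relational notions [is_series] and [is_derive] on [C_R_NormedModule]. *)
Definition CSeries (a : nat -> C) : C :=
  (Series (fun n => Re (a n)), Series (fun n => Im (a n))).
Definition ex_Cseries (a : nat -> C) : Prop :=
  @ex_series R_AbsRing C_R_NormedModule a.
Definition CDerive (f : R -> C) (t : R) : C :=
  (Derive (fun s => Re (f s)) t, Derive (fun s => Im (f s)) t).

Lemma CSeries_unique (a : nat -> C) (l : C) :
  @is_series R_AbsRing C_R_NormedModule a l -> CSeries a = l.
Proof.
intros H.
assert (Hre : forall n, sum_n (fun k => Re (a k)) n
                        = Re (@sum_n C_R_NormedModule a n)).
{ induction n as [|n IH].
  - now rewrite !sum_O.
  - now rewrite !sum_Sn, IH. }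
assert (Him : forall n, sum_n (fun k => Im (a k)) n
                        = Im (@sum_n C_R_NormedModule a n)).
{ induction n as [|n IH].
  - now rewrite !sum_O.
  - now rewrite !sum_Sn, IH. }
unfold CSeries; rewrite (surjective_pairing l); f_equal; apply is_series_unique.
- apply filterlim_ext with (1 := fun n => eq_sym (Hre n)).
  apply (filterlim_comp _ _ _ _ (fun z : C => Re z) _ _ _ H).
  intros P [e He]; exists e; intros z [Hz _]; now apply He.
- apply filterlim_ext with (1 := fun n => eq_sym (Him n)).
  apply (filterlim_comp _ _ _ _ (fun z : C => Im z) _ _ _ H).
  intros P [e He]; exists e; intros z [_ Hz]; now apply He.
Qed.

Lemma CDerive_unique (f : R -> C) (t : R) (l : C) :
  @is_derive R_AbsRing C_R_NormedModule f t l -> CDerive f t = l.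
Proof.
intros H.
unfold CDerive; rewrite (surjective_pairing l); f_equal; apply is_derive_unique.
- apply (filterdiff_comp' f (fst : C_R_NormedModule -> R_NormedModule) t _ fst H).
  apply filterdiff_linear, is_linear_fst.
- apply (filterdiff_comp' f (snd : C_R_NormedModule -> R_NormedModule) t _ snd H).
  apply filterdiff_linear, is_linear_snd.
Qed.

(* q = exp (i * PI * tau) with tau = i * PI * t. *)
Definition nome (t : R) : R := exp (- (PI ^ 2 * t)).

Definition theta1 (u : C) (t : R) : C :=
  (2 * CSeries (fun n => RtoC ((-1) ^ n * Rpower (nome t) ((INR n + 1 / 2) ^ 2))
                         * Csin (RtoC ((2 * INR n + 1) * PI) * u)))%C.

Definition theta2 (u : C) (t : R) : C :=
  (2 * CSeries (fun n => RtoC (Rpower (nome t) ((INR n + 1 / 2) ^ 2))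
                         * Ccos (RtoC ((2 * INR n + 1) * PI) * u)))%C.

(* The sums over n >= 1 are reindexed by n = S m. *)
Definition theta3 (u : C) (t : R) : C :=
  (1 + 2 * CSeries (fun m => let n := S m in
                      RtoC (nome t ^ (n ^ 2)) * Ccos (RtoC (2 * INR n * PI) * u)))%C.

Definition theta4 (u : C) (t : R) : C :=
  (1 + 2 * CSeries (fun m => let n := S m in
                      RtoC ((-1) ^ n * nome t ^ (n ^ 2))
                      * Ccos (RtoC (2 * INR n * PI) * u)))%C.

Definition dt (F : C -> R -> C) (u : C) (t : R) : C := CDerive (fun s => F u s) t.
Definition du (F : C -> R -> C) (u : C) (t : R) : C := C_derive (fun v => F v t) u.

(* L = sum_k a k = 2 * sum_k b k, both series being convergent. *)
Definition two_expansions (L : C) (a b : nat -> C) : Prop :=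
  ex_Cseries a /\ ex_Cseries b /\ L = CSeries a /\ CSeries a = (2 * CSeries b)%C.

(* Main.v *)
Require Import Defs.
From Stdlib Require Import Reals Lra Lia.
From Coquelicot Require Import Coquelicot.

(** Each identity is the logarithmic derivative in t of a product expansion.
    With w = sin^2(pi u), the Jacobi triple product gives
      theta4(u,t) = theta4(0,t) * prod_(k >= 0) (1 + w / sinh^2((k + 1/2) pi^2 t)),
      theta1(u,t) = (theta1'(0,t) / pi) * sin(pi u)
                      * prod_(k >= 1) (1 + w / sinh^2(k pi^2 t)),
    where theta1' is the derivative in u, and theta3, theta2 are theta4, theta1 at
    u + 1/2, which turns sin^2(pi u) into cos^2(pi u).  The t-derivative of
    log(1 + w / sinh^2(l t)) is - 2 l coth(l t) w / (sinh^2(l t) + w), whence the first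
    form of each series; the second one comes from
    2 (sinh^2 x + w) = cosh(2x) - cos(2 pi u).  In particular the constant that goes
    with theta2 is theta1'(0,t), like for theta1.  Only quotients of theta series
    occur, so that the constant of the triple product never has to be computed.

    Both cases are treated at once, with a parameter m: m = 0 for theta4 and m = 1 for
    theta1.  The theta series is then the sum over n of (-1)^n q^(n^2 + m n) Z_n, up to
    a power of q, where Z is 1, 2 cos(2 pi u), 2 cos(4 pi u), ... for m = 0 and
    sin(pi u), sin(3 pi u), ... for m = 1.

    The product expansion follows Cauchy.  In [cauchy_coeff] the coefficients
    (-1)^n q^(n^2 + m n) are multiplied by truncating quotients of Gaussian binomials
    that vanish for n > N.  The recurrence [cauchy_coeff_recurrence] says that, up to
    the scalar [cauchy_ratio], passing from N to N + 1 multiplies the finite sum by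
    1 - 2 g cos(2 pi u) + g^2 with g = q^(2N + 1 + m) ([finite_theta_step]).  It uses
    only the three-term relation of Z, which the sequences at u = 0 (1, 2, 2, ... and,
    after division by sin(pi u), 1, 3, 5, ...) share with cos(2 pi u) replaced by 1.
    Dividing the two cancels the scalars, and dominated convergence as N tends to
    infinity gives [theta_sum_quotient].

    On the analytic side, an infinite product prod (1 + a_k) is written as the series
    1 + sum_n (prod_(k < n) (1 + a_k)) a_n.  Termwise differentiation of this series
    gives its derivative ([is_Cderive_Cinfprod]), and it is nonzero because
    prod (1 - a_k / (1 + a_k)) is its inverse ([Cinfprod_neq_0]).  The strip condition
    on Im u is what keeps |1 + a_k| away from 0 ([factor_plus_1_ge]).  Finally
    theta4(0,t) is nonzero because its product with a convergent product is the
    positive number theta3(0,t) ([theta_null_0_neq_0]). *)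

Local Open Scope R_scope.

(** * Series dominated by a convergent series *)

Lemma Rabs_Series_le_tail (a M : nat -> R) (N : nat) :
  ex_series M -> (forall n, Rabs (a n) <= M n) ->
  Rabs (Series a - sum_n a N) <= Series M - sum_n M N.
Proof.
intros HM Ha.
assert (Hea : ex_series (fun n => Rabs (a n))).
{ apply (@ex_series_le R_AbsRing R_CompleteNormedModule) with M; [|exact HM].
  intros n; unfold norm; simpl; unfold abs; simpl; rewrite Rabs_Rabsolu; apply Ha. }
assert (Ha' := ex_series_Rabs _ Hea).
rewrite (Series_incr_n a (S N)) by (auto; lia).
rewrite (Series_incr_n M (S N)) by (auto; lia).
rewrite !sum_n_Reals; simpl pred.
replace (_ - _) with (Series (fun k => a (S N + k)%nat)) by ring.
replace (_ - _) with (Series (fun k => M (S N + k)%nat)) by ring.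
eapply Rle_trans; [apply Series_Rabs|].
- apply (ex_series_incr_n (fun n => Rabs (a n)) (S N)), Hea.
- apply Series_le; [|now apply (ex_series_incr_n M (S N))].
  intros n; split; [apply Rabs_pos|apply Ha].
Qed.

Lemma sum_n_le_Series (M : nat -> R) (n : nat) :
  ex_series M -> (forall n, 0 <= M n) -> sum_n M n <= Series M.
Proof.
intros HM Hp.
assert (H : forall k, Rabs (0 * M k) <= M k).
{ intros k; rewrite Rmult_0_l, Rabs_R0; apply Hp. }
generalize (Rabs_Series_le_tail _ _ n HM H); intros H'.
generalize (Rabs_pos (Series (fun k => 0 * M k) - sum_n (fun k => 0 * M k) n)); lra.
Qed.

(** Tannery's theorem: the tails of all the series are below the same tail of M, and a
    finite sum passes to the limit. *)
Lemma Series_dominated {T : Type} (F : (T -> Prop) -> Prop) {FF : Filter F}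
  (a : T -> nat -> R) (l M : nat -> R) :
  ex_series M ->
  F (fun x => forall n, Rabs (a x n) <= M n) ->
  (forall n, Rabs (l n) <= M n) ->
  (forall n, filterlim (fun x => a x n) F (locally (l n))) ->
  filterlim (fun x => Series (a x)) F (locally (Series l)).
Proof.
intros HM Hdom Hl Hlim.
apply filterlim_locally; intros eps.
assert (He : 0 < eps / 3) by (destruct eps as [e p]; simpl; lra).
assert (HN : exists N, Series M - sum_n M N < eps / 3).
{ destruct (proj1 (filterlim_locally _ _) (Series_correct M HM) (mkposreal _ He))
    as [N HN].
  exists N; specialize (HN N (Nat.le_refl N)).
  change (Rabs (sum_n M N - Series M) < eps / 3) in HN; apply Rabs_def2 in HN; lra. }
destruct HN as [N HN].
(* Both tails beyond N and the difference of the finite sums are below eps / 3. *)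
assert (Hsum : filterlim (fun x => sum_n (a x) N) F (locally (sum_n l N))).
{ clear HN; induction N as [|N IH].
  - rewrite sum_O; apply filterlim_ext with (fun x => a x O); [|apply Hlim].
    intros x; now rewrite sum_O.
  - rewrite sum_Sn.
    apply filterlim_ext with (fun x => plus (sum_n (a x) N) (a x (S N))).
    { intros x; now rewrite sum_Sn. }
    eapply filterlim_comp_2; [exact IH|apply Hlim|].
    apply (filterlim_plus (K := R_AbsRing) (V := R_NormedModule)). }
assert (Hs := proj1 (filterlim_locally _ _) Hsum (mkposreal _ He)).
generalize (filter_and _ _ Hdom Hs); apply filter_imp.
intros x [Hx Hx'].
assert (H1 := Rabs_Series_le_tail _ _ N HM Hx).
assert (H2 := Rabs_Series_le_tail _ _ N HM Hl).
change (Rabs (Series (a x) - Series l) < eps).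
change (Rabs (sum_n (a x) N - sum_n l N) < eps / 3) in Hx'.
replace (Series (a x) - Series l) with
  ((Series (a x) - sum_n (a x) N) + (sum_n (a x) N - sum_n l N)
   - (Series l - sum_n l N)) by ring.
eapply Rle_lt_trans; [apply Rabs_triang|]; rewrite Rabs_Ropp.
eapply Rle_lt_trans; [apply Rplus_le_compat_r, Rabs_triang|]; lra.
Qed.

Lemma ex_series_dominated (a M : nat -> R) :
  ex_series M -> (forall n, Rabs (a n) <= M n) -> ex_series a.
Proof. intros HM Ha; now apply (@ex_series_le R_AbsRing R_CompleteNormedModule) with M. Qed.

(** By the mean value theorem M also dominates the difference quotients, so that
    dominated convergence applies to them. *)
Lemma is_derive_Series (f f' : nat -> R -> R) (M : nat -> R) (x d : R) :
  0 < d -> ex_series M ->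
  (forall n y, Rabs (y - x) < d -> is_derive (f n) y (f' n y)) ->
  (forall n y, Rabs (y - x) < d -> Rabs (f' n y) <= M n) ->
  (forall y, Rabs (y - x) < d -> ex_series (fun n => f n y)) ->
  is_derive (fun y => Series (fun n => f n y)) x (Series (fun n => f' n x)).
Proof.
intros Hd HM Hder Hbound Hex.
assert (Hx0 : Rabs (x - x) < d) by (rewrite Rminus_diag, Rabs_R0; exact Hd).
assert (Hlim : filterlim (fun h => Series (fun n => (f n (x + h) - f n x) / h))
                 (locally' 0) (locally (Series (fun n => f' n x)))).
{ apply (Series_dominated (locally' 0)) with M; [exact HM| | |].
  - exists (mkposreal d Hd); intros h Hh Hh0 n.
    change (Rabs (h - 0) < d) in Hh; rewrite Rminus_0_r in Hh.
    destruct (MVT_gen (f n) x (x + h) (f' n)) as [c [Hc Heq]].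
    + intros y Hy; apply Hder.
      unfold Rmin, Rmax in Hy; destruct (Rle_dec x (x + h)); apply Rabs_def2 in Hh;
        apply Rabs_def1; lra.
    + intros y Hy; apply continuity_pt_filterlim, (ex_derive_continuous (f n)).
      exists (f' n y); apply Hder.
      unfold Rmin, Rmax in Hy; destruct (Rle_dec x (x + h)); apply Rabs_def2 in Hh;
        apply Rabs_def1; lra.
    + rewrite Heq; replace (f' n c * (x + h - x) / h) with (f' n c) by now field.
      apply Hbound.
      unfold Rmin, Rmax in Hc; destruct (Rle_dec x (x + h)); apply Rabs_def2 in Hh;
        apply Rabs_def1; lra.
  - intros n; now apply Hbound.
  - intros n; apply filterlim_locally; intros eps.
    destruct (proj1 (is_derive_Reals _ _ _) (Hder n x Hx0) eps (cond_pos eps))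
      as [e He].
    exists e; intros h Hh Hh0; change (Rabs (h - 0) < e) in Hh.
    rewrite Rminus_0_r in Hh; now apply He. }
apply is_derive_Reals; intros eps Heps.
destruct (proj1 (filterlim_locally _ _) Hlim (mkposreal _ Heps)) as [e He].
assert (Hm : 0 < Rmin e d) by (apply Rmin_pos; [apply cond_pos|exact Hd]).
exists (mkposreal _ Hm); intros h Hh0 Hh; simpl in Hh.
assert (Hhe : Rabs h < e) by (eapply Rlt_le_trans; [exact Hh|apply Rmin_l]).
assert (Hhd : Rabs h < d) by (eapply Rlt_le_trans; [exact Hh|apply Rmin_r]).
specialize (He h); change (Rabs (h - 0) < e -> h <> 0 ->
  Rabs (Series (fun n => (f n (x + h) - f n x) / h) - Series (fun n => f' n x)) < eps)
  in He.
rewrite Rminus_0_r in He.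
replace ((Series (fun n => f n (x + h)) - Series (fun n => f n x)) / h)
  with (Series (fun n => (f n (x + h) - f n x) / h)); [now apply He|].
unfold Rdiv at 1; rewrite Series_scal_r; unfold Rdiv; f_equal; apply Series_minus.
- apply Hex; now replace (x + h - x) with h by ring.
- now apply Hex.
Qed.

(** * Limits, derivatives and series of complex numbers, by components *)

Definition is_Clim_seq (u : nat -> C) (l : C) : Prop :=
  is_lim_seq (fun n => Re (u n)) (Re l) /\ is_lim_seq (fun n => Im (u n)) (Im l).

Definition is_Cderive (f : R -> C) (t : R) (l : C) : Prop :=
  is_derive (fun s => Re (f s)) t (Re l) /\ is_derive (fun s => Im (f s)) t (Im l).

Lemma im_le_Cmod (z : C) : Rabs (Im z) <= Cmod z.
Proof. eapply Rle_trans; [apply Rmax_r|apply (Rmax_Cmod z)]. Qed.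

Lemma is_Clim_seq_unique (u : nat -> C) (l l' : C) :
  is_Clim_seq u l -> is_Clim_seq u l' -> l = l'.
Proof.
intros [H1 H2] [H1' H2'].
apply is_lim_seq_unique in H1, H2, H1', H2'.
rewrite H1 in H1'; rewrite H2 in H2'.
destruct l as [x y], l' as [x' y']; simpl in *.
now injection H1' as ->; injection H2' as ->.
Qed.

Lemma is_Clim_seq_ext (u v : nat -> C) (l : C) :
  (forall n, u n = v n) -> is_Clim_seq u l -> is_Clim_seq v l.
Proof.
intros E [H1 H2]; split; [revert H1|revert H2]; apply is_lim_seq_ext; intros n;
  now rewrite E.
Qed.

Lemma is_Clim_seq_ext_loc (u v : nat -> C) (l : C) (N : nat) :
  (forall n, (N <= n)%nat -> u n = v n) -> is_Clim_seq u l -> is_Clim_seq v l.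
Proof.
intros E [H1 H2]; split; [revert H1|revert H2]; apply is_lim_seq_ext_loc; exists N;
  intros n Hn; now rewrite E.
Qed.

Lemma is_Clim_seq_incr_n (u : nat -> C) (k : nat) (l : C) :
  is_Clim_seq u l -> is_Clim_seq (fun n => u (n + k)%nat) l.
Proof.
intros [H1 H2]; split.
- now apply (is_lim_seq_incr_n (fun n => Re (u n))).
- now apply (is_lim_seq_incr_n (fun n => Im (u n))).
Qed.

Lemma is_Clim_seq_const (c : C) : is_Clim_seq (fun _ => c) c.
Proof. split; apply is_lim_seq_const. Qed.

Lemma is_Clim_seq_mult (u v : nat -> C) (l m : C) :
  is_Clim_seq u l -> is_Clim_seq v m -> is_Clim_seq (fun n => (u n * v n)%C) (l * m)%C.
Proof.
intros [H1 H2] [H3 H4]; split; simpl.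
- apply is_lim_seq_minus'; now apply is_lim_seq_mult'.
- apply is_lim_seq_plus'; now apply is_lim_seq_mult'.
Qed.

Lemma is_Cderive_unique (f : R -> C) (t : R) (l : C) : is_Cderive f t l -> CDerive f t = l.
Proof.
intros [H1 H2]; rewrite (surjective_pairing l); unfold CDerive; f_equal;
  now apply is_derive_unique.
Qed.

Lemma is_Cderive_ext_loc (f g : R -> C) (t : R) (l : C) :
  locally t (fun s => f s = g s) -> is_Cderive f t l -> is_Cderive g t l.
Proof.
intros E [H1 H2]; split; eapply is_derive_ext_loc; try eassumption;
  revert E; apply filter_imp; intros s ->; reflexivity.
Qed.

Lemma is_Cderive_mult (f g : R -> C) (t : R) (f' g' : C) :
  is_Cderive f t f' -> is_Cderive g t g' ->
  is_Cderive (fun s => (f s * g s)%C) t (f' * g t + f t * g')%C.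
Proof.
intros [H1 H2] [H3 H4]; split; simpl; apply is_derive_Reals.
- replace (_ + _) with
    ((fst f' * fst (g t) + fst (f t) * fst g')
     - (snd f' * snd (g t) + snd (f t) * snd g')) by ring.
  apply derivable_pt_lim_minus;
    (apply (derivable_pt_lim_mult (fun s => fst (f s)) (fun s => fst (g s))) ||
     apply (derivable_pt_lim_mult (fun s => snd (f s)) (fun s => snd (g s))));
    now apply is_derive_Reals.
- replace (_ + _) with
    ((fst f' * snd (g t) + fst (f t) * snd g')
     + (snd f' * fst (g t) + snd (f t) * fst g')) by ring.
  apply derivable_pt_lim_plus;
    [apply (derivable_pt_lim_mult (fun s => fst (f s)) (fun s => snd (g s)))
    |apply (derivable_pt_lim_mult (fun s => snd (f s)) (fun s => fst (g s)))];
    now apply is_derive_Reals.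
Qed.

Lemma is_Cderive_plus_l (c : C) (f : R -> C) (t : R) (l : C) :
  is_Cderive f t l -> is_Cderive (fun s => c + f s)%C t l.
Proof.
intros [H1 H2]; split; simpl; apply is_derive_Reals.
- replace (Re l) with (0 + Re l) by ring.
  apply (derivable_pt_lim_plus (fun _ => fst c) (fun s => fst (f s)));
    [apply derivable_pt_lim_const|now apply is_derive_Reals].
- replace (Im l) with (0 + Im l) by ring.
  apply (derivable_pt_lim_plus (fun _ => snd c) (fun s => snd (f s)));
    [apply derivable_pt_lim_const|now apply is_derive_Reals].
Qed.

Lemma is_Cderive_RtoC (f : R -> R) (t l : R) :
  is_derive f t l -> is_Cderive (fun s => RtoC (f s)) t (RtoC l).
Proof. intros H; split; simpl; [exact H|exact (is_derive_const (0 : R) t)]. Qed.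

Lemma is_Cderive_const (c : C) (t : R) : is_Cderive (fun _ => c) t 0%C.
Proof. split; [exact (is_derive_const (Re c) t)|exact (is_derive_const (Im c) t)]. Qed.

Lemma ex_Cseries_dominated (a : nat -> C) (M : nat -> R) :
  ex_series M -> (forall n, Cmod (a n) <= M n) -> ex_Cseries a.
Proof.
intros HM Ha.
apply (@ex_series_le R_AbsRing C_R_CompleteNormedModule) with M; [|exact HM].
intros n; eapply Rle_trans; [right; symmetry; exact (Cmod_norm (a n))|apply Ha].
Qed.

Lemma CSeries_ext (a b : nat -> C) : (forall n, a n = b n) -> CSeries a = CSeries b.
Proof.
intros E; unfold CSeries; f_equal; apply Series_ext; intros n; now rewrite E.
Qed.

Lemma CSeries_scal (c : C) (a : nat -> C) (M : nat -> R) :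
  ex_series M -> (forall n, Cmod (a n) <= M n) ->
  CSeries (fun n => c * a n)%C = (c * CSeries a)%C.
Proof.
intros HM Ha.
assert (H1 : ex_series (fun n => Re (a n))).
{ apply ex_series_dominated with M; auto; intros n.
  eapply Rle_trans; [apply re_le_Cmod|apply Ha]. }
assert (H2 : ex_series (fun n => Im (a n))).
{ apply ex_series_dominated with M; auto; intros n.
  eapply Rle_trans; [apply im_le_Cmod|apply Ha]. }
unfold CSeries; rewrite (surjective_pairing c); unfold Cmult; simpl; f_equal.
- rewrite <- !Series_scal_l; apply Series_minus; now apply (ex_series_scal_l (V := R_NormedModule)).
- rewrite <- !Series_scal_l; apply Series_plus; now apply (ex_series_scal_l (V := R_NormedModule)).
Qed.

Lemma CSeries_RtoC (a : nat -> R) : CSeries (fun n => RtoC (a n)) = RtoC (Series a).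
Proof.
unfold CSeries, RtoC; simpl; f_equal.
rewrite (Series_ext _ (fun n => 0 * 0)) by (intros; ring).
rewrite Series_scal_l; ring.
Qed.

Lemma CSeries_incr_1 (a : nat -> C) (M : nat -> R) :
  ex_series M -> (forall n, Cmod (a n) <= M n) ->
  CSeries a = (a 0%nat + CSeries (fun n => a (S n)))%C.
Proof.
intros HM Ha; unfold CSeries, Cplus; simpl; f_equal; apply Series_incr_1;
  apply ex_series_dominated with M; auto; intros n;
  (eapply Rle_trans; [|apply Ha]); [apply re_le_Cmod|apply im_le_Cmod].
Qed.

Lemma two_expansions_ext (L : C) (a a' b b' : nat -> C) :
  (forall k, a k = a' k) -> (forall k, b k = b' k) ->
  two_expansions L a b -> two_expansions L a' b'.
Proof.
intros Ha Hb (H1 & H2 & H3 & H4); repeat split.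
- now apply ex_series_ext with a.
- now apply ex_series_ext with b.
- now rewrite <- (CSeries_ext _ _ Ha).
- now rewrite <- (CSeries_ext _ _ Ha), <- (CSeries_ext _ _ Hb).
Qed.

Lemma is_lim_seq_partial_sums (u a : nat -> R) :
  ex_series a -> (forall n, u (S n) = u n + a n) -> is_lim_seq u (u O + Series a).
Proof.
intros Ha Hu; apply is_lim_seq_incr_1.
apply is_lim_seq_ext with (fun n => u O + sum_n a n).
- induction n as [|n IH]; [now rewrite sum_O, Hu|].
  rewrite sum_Sn, Hu, <- IH; unfold plus; simpl; ring.
- apply is_lim_seq_plus'; [apply is_lim_seq_const|exact (Series_correct _ Ha)].
Qed.

(** Any sequence whose increments are the terms serves as sequence of partial sums.
    This identifies sums of series with limits of products, or of their derivatives,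
    by comparing increments. *)
Lemma is_Clim_seq_partial_sums (u a : nat -> C) (M : nat -> R) :
  ex_series M -> (forall n, Cmod (a n) <= M n) ->
  (forall n, u (S n) = (u n + a n)%C) -> is_Clim_seq u (u O + CSeries a)%C.
Proof.
intros HM Ha Hu; split; simpl.
- apply (is_lim_seq_partial_sums (fun n => Re (u n)) (fun n => Re (a n))).
  + apply ex_series_dominated with M; auto; intros n.
    eapply Rle_trans; [apply re_le_Cmod|apply Ha].
  + intros n; now rewrite Hu.
- apply (is_lim_seq_partial_sums (fun n => Im (u n)) (fun n => Im (a n))).
  + apply ex_series_dominated with M; auto; intros n.
    eapply Rle_trans; [apply im_le_Cmod|apply Ha].
  + intros n; now rewrite Hu.
Qed.

Fixpoint Csum (a : nat -> C) (n : nat) : C :=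
  match n with O => 0%C | S n => (Csum a n + a n)%C end.

Lemma is_Clim_seq_Csum (a : nat -> C) (M : nat -> R) :
  ex_series M -> (forall n, Cmod (a n) <= M n) -> is_Clim_seq (Csum a) (CSeries a).
Proof.
intros HM Ha; rewrite <- (Cplus_0_l (CSeries a)).
now apply (is_Clim_seq_partial_sums (Csum a) a M).
Qed.

Lemma CSeries_dominated (a : nat -> nat -> C) (l : nat -> C) (M : nat -> R) :
  ex_series M ->
  (forall N n, Cmod (a N n) <= M n) -> (forall n, Cmod (l n) <= M n) ->
  (forall n, is_Clim_seq (fun N => a N n) (l n)) ->
  is_Clim_seq (fun N => CSeries (a N)) (CSeries l).
Proof.
intros HM Ha Hl Hlim; split; simpl.
- apply (Series_dominated eventually (fun N n => Re (a N n)) (fun n => Re (l n)) M HM).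
  + apply filter_forall; intros N n; eapply Rle_trans; [apply re_le_Cmod|apply Ha].
  + intros n; eapply Rle_trans; [apply re_le_Cmod|apply Hl].
  + intros n; apply Hlim.
- apply (Series_dominated eventually (fun N n => Im (a N n)) (fun n => Im (l n)) M HM).
  + apply filter_forall; intros N n; eapply Rle_trans; [apply im_le_Cmod|apply Ha].
  + intros n; eapply Rle_trans; [apply im_le_Cmod|apply Hl].
  + intros n; apply Hlim.
Qed.

Lemma is_Cderive_CSeries (f f' : nat -> R -> C) (M M' : nat -> R) (t d : R) :
  0 < d -> ex_series M -> ex_series M' ->
  (forall n s, Rabs (s - t) < d -> is_Cderive (f n) s (f' n s)) ->
  (forall n s, Rabs (s - t) < d -> Cmod (f n s) <= M n) ->
  (forall n s, Rabs (s - t) < d -> Cmod (f' n s) <= M' n) ->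
  is_Cderive (fun s => CSeries (fun n => f n s)) t (CSeries (fun n => f' n t)).
Proof.
intros Hd HM HM' Hder Hf Hf'; split; simpl.
- apply (is_derive_Series (fun n s => Re (f n s)) (fun n s => Re (f' n s)) M' t d); auto.
  + intros n s Hs; now apply Hder.
  + intros n s Hs; eapply Rle_trans; [apply re_le_Cmod|now apply Hf'].
  + intros s Hs; apply ex_series_dominated with M; auto; intros n.
    eapply Rle_trans; [apply re_le_Cmod|now apply Hf].
- apply (is_derive_Series (fun n s => Im (f n s)) (fun n s => Im (f' n s)) M' t d); auto.
  + intros n s Hs; now apply Hder.
  + intros n s Hs; eapply Rle_trans; [apply im_le_Cmod|now apply Hf'].
  + intros s Hs; apply ex_series_dominated with M; auto; intros n.
    eapply Rle_trans; [apply im_le_Cmod|now apply Hf].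
Qed.

(** * Inequalities for exp, sinh and cosh *)

Lemma exp_mono (x y : R) : x <= y -> exp x <= exp y.
Proof. intros [H| ->]; [left; now apply exp_increasing|right; reflexivity]. Qed.

Lemma INR_plus_1_le_exp (n : nat) : INR n + 1 <= exp (INR n).
Proof.
destruct n as [|n]; [simpl; rewrite exp_0; lra|].
rewrite Rplus_comm; left; apply exp_ineq1, not_0_INR; lia.
Qed.

Lemma exp_pow (x : R) (k : nat) : exp x ^ k = exp (INR k * x).
Proof.
induction k as [|k IH]; [simpl; rewrite Rmult_0_l; now rewrite exp_0|].
rewrite <- tech_pow_Rmult, IH, <- exp_plus, S_INR; f_equal; ring.
Qed.

Lemma cosh_le_exp (x y : R) : Rabs x <= y -> cosh x <= exp y.
Proof.
intros H; unfold cosh.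
assert (H1 : exp x <= exp y) by (apply exp_mono; generalize (Rle_abs x); lra).
assert (H2 : exp (- x) <= exp y).
{ apply exp_mono; generalize (Rle_abs (- x)); rewrite Rabs_Ropp; lra. }
lra.
Qed.

Lemma sinh_pos (x : R) : 0 < x -> 0 < sinh x.
Proof. intros Hx; rewrite <- sinh_0; now apply sinh_lt. Qed.

Lemma sinh2_cosh (x : R) : 2 * sinh x ^ 2 = cosh (2 * x) - 1.
Proof.
unfold sinh, cosh.
replace (2 * x) with (x + x) by ring; replace (- (x + x)) with (- x + - x) by ring.
rewrite !exp_plus.
assert (H : exp x * exp (- x) = 1) by (rewrite <- exp_plus, Rplus_opp_r; apply exp_0).
nra.
Qed.

(** cosh y - cosh x = 2 sinh((x + y)/2) sinh((y - x)/2). *)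
Lemma cosh_lt (x y : R) : 0 <= x < y -> cosh x < cosh y.
Proof.
intros [Hx Hy].
assert (H0 : 0 < cosh ((x + y) / 2)).
{ unfold cosh; generalize (exp_pos ((x + y) / 2)) (exp_pos (- ((x + y) / 2))); lra. }
assert (Hb : 0 < sinh ((x + y) / 2)) by (apply sinh_pos; lra).
assert (Ha : 0 < sinh ((y - x) / 2)) by (apply sinh_pos; lra).
assert (Hd : cosh y - cosh x = 2 * (sinh ((x + y) / 2) * sinh ((y - x) / 2))).
{ unfold cosh, sinh.
  set (a := (x + y) / 2); set (b := (y - x) / 2).
  replace x with (a + - b) by (unfold a, b; field).
  replace y with (a + b) by (unfold a, b; field).
  replace (- (a + - b)) with (- a + b) by ring.
  replace (- (a + b)) with (- a + - b) by ring.
  rewrite !exp_plus; field. }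
assert (0 < sinh ((x + y) / 2) * sinh ((y - x) / 2)) by now apply Rmult_lt_0_compat.
lra.
Qed.

Lemma cosh_Rabs (x : R) : cosh (Rabs x) = cosh x.
Proof.
unfold cosh, Rabs; destruct (Rcase_abs x); [|reflexivity].
rewrite Ropp_involutive; f_equal; ring.
Qed.

Lemma cosh_ge_1 (x : R) : 1 <= cosh x.
Proof.
rewrite <- cosh_0, <- (cosh_Rabs x).
destruct (Rabs_pos x) as [H|<-]; [left; apply cosh_lt; lra|right; reflexivity].
Qed.

(** * Infinite products *)

Fixpoint Cprod (a : nat -> C) (n : nat) : C :=
  match n with O => 1%C | S n => (Cprod a n * (1 + a n))%C end.

(** The limit of the partial products, as the telescoping sum of their increments.
    In this form it can be differentiated term by term. *)
Definition Cinfprod (a : nat -> C) : C := (1 + CSeries (fun n => Cprod a n * a n))%C.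

Section Product.
Variables (a : nat -> C) (M : nat -> R).
Hypothesis HM : ex_series M.
Hypothesis Ha : forall n, Cmod (a n) <= M n.

Let M_pos : forall n, 0 <= M n.
Proof. intros n; eapply Rle_trans; [apply Cmod_ge_0|apply Ha]. Qed.

Lemma Cmod_Cprod_step n E :
  Cmod (Cprod a n) <= exp E -> Cmod (Cprod a (S n)) <= exp (E + M n).
Proof.
intros H; simpl; rewrite Cmod_mult, exp_plus.
apply Rmult_le_compat; auto using Cmod_ge_0.
eapply Rle_trans; [apply Cmod_triangle|]; rewrite Cmod_1.
eapply Rle_trans; [apply Rplus_le_compat_l, Ha|].
destruct (Req_dec (M n) 0) as [->|Hn]; [rewrite exp_0; lra|].
left; now apply exp_ineq1.
Qed.

Lemma Cmod_Cprod_sum n : Cmod (Cprod a (S n)) <= exp (sum_n M n).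
Proof.
induction n as [|n IH].
- rewrite sum_O; rewrite <- (Rplus_0_l (M O)); apply Cmod_Cprod_step; simpl.
  rewrite Cmod_1, exp_0; lra.
- rewrite sum_Sn; now apply Cmod_Cprod_step.
Qed.

Lemma Cmod_Cprod_le n : Cmod (Cprod a n) <= exp (Series M).
Proof.
destruct n as [|n].
- simpl; rewrite Cmod_1, <- exp_0.
  destruct (sum_n_le_Series M O HM M_pos) as [H|H]; rewrite sum_O in H;
    specialize (M_pos O); apply exp_mono; lra.
- eapply Rle_trans; [apply Cmod_Cprod_sum|].
  apply exp_mono, sum_n_le_Series; auto.
Qed.

Lemma Cmod_Cprod_term n : Cmod (Cprod a n * a n)%C <= exp (Series M) * M n.
Proof.
rewrite Cmod_mult; apply Rmult_le_compat; auto using Cmod_ge_0, Cmod_Cprod_le.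
Qed.

Lemma is_Clim_seq_Cprod : is_Clim_seq (Cprod a) (Cinfprod a).
Proof.
apply (is_Clim_seq_partial_sums (Cprod a) (fun n => Cprod a n * a n)%C
         (fun n => exp (Series M) * M n)).
- now apply (ex_series_scal_l (V := R_NormedModule)).
- exact Cmod_Cprod_term.
- intros n; simpl; ring.
Qed.

End Product.

(** With b = - a / (1 + a) one has (1 + a) (1 + b) = 1, so the product of the 1 + b_n,
    which also converges, is an inverse. *)
Lemma Cinfprod_neq_0 (a : nat -> C) (M M' : nat -> R) :
  ex_series M -> (forall n, Cmod (a n) <= M n) ->
  (forall n, (1 + a n)%C <> 0%C) ->
  ex_series M' -> (forall n, Cmod (a n / (1 + a n))%C <= M' n) ->
  Cinfprod a <> 0%C.
Proof.
intros HM Ha Hnz HM' Ha' H0.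
set (b := fun n => (- (a n / (1 + a n)))%C).
assert (Hb : forall n, Cmod (b n) <= M' n) by (intros n; unfold b; rewrite Cmod_opp; auto).
assert (Hab : forall n, (Cprod a n * Cprod b n = 1)%C).
{ induction n as [|n IH]; simpl; [ring|].
  transitivity ((Cprod a n * Cprod b n) * ((1 + a n) * (1 + b n)))%C; [ring|].
  rewrite IH; unfold b; field; apply Hnz. }
assert (H1 := is_Clim_seq_mult _ _ _ _ (is_Clim_seq_Cprod a M HM Ha)
                (is_Clim_seq_Cprod b M' HM' Hb)).
apply (is_Clim_seq_ext _ (fun _ => 1%C)) in H1; [|exact Hab].
rewrite H0, Cmult_0_l in H1.
apply C1_nz, (is_Clim_seq_unique _ _ _ (is_Clim_seq_const 1%C) H1).
Qed.

(** The derivative of the partial product, by the product rule.  No division by 1 + a_n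
    is made, so that it can be bounded uniformly near t. *)
Fixpoint Cprod' (a a' : nat -> C) (n : nat) : C :=
  match n with
  | O => 0%C
  | S n => (Cprod' a a' n * (1 + a n) + Cprod a n * a' n)%C
  end.

Lemma is_Cderive_Cprod (a : nat -> R -> C) (a' : nat -> C) (s : R) (n : nat) :
  (forall n, is_Cderive (a n) s (a' n)) ->
  is_Cderive (fun s => Cprod (fun k => a k s) n) s (Cprod' (fun k => a k s) a' n).
Proof.
intros H; induction n as [|n IH]; simpl; [apply is_Cderive_const|].
apply (is_Cderive_mult (fun s => Cprod (fun k => a k s) n) (fun s => 1 + a n s)%C);
  [exact IH|].
apply is_Cderive_plus_l, H.
Qed.

(* The bound A exp A, with A the sum of M so far, is stable under the product rule. *)
Lemma Cmod_Cprod'_le (a a' : nat -> C) (M : nat -> R) (n : nat) :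
  ex_series M -> (forall n, Cmod (a n) <= M n) -> (forall n, Cmod (a' n) <= M n) ->
  Cmod (Cprod' a a' n) <= Series M * exp (Series M).
Proof.
intros HM Ha Ha'.
assert (Mp : forall n, 0 <= M n).
{ intros k; eapply Rle_trans; [apply Cmod_ge_0|apply Ha]. }
assert (Hstep : forall n A E, 0 <= A -> Cmod (Cprod a n) <= exp E ->
  Cmod (Cprod' a a' n) <= A * exp E ->
  Cmod (Cprod' a a' (S n)) <= (A + M n) * exp (E + M n)).
{ intros k A E HA HE HD; simpl.
  assert (Hexp : 1 + M k <= exp (M k)).
  { destruct (Req_dec (M k) 0) as [->|Hn]; [rewrite exp_0; lra|].
    left; now apply exp_ineq1. }
  assert (HEp := exp_pos E).
  eapply Rle_trans; [apply Cmod_triangle|]; rewrite !Cmod_mult, exp_plus.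
  replace ((A + M k) * (exp E * exp (M k)))
    with (A * exp E * exp (M k) + exp E * exp (M k) * M k) by ring.
  apply Rplus_le_compat.
  - apply Rmult_le_compat; auto using Cmod_ge_0.
    eapply Rle_trans; [apply Cmod_triangle|]; rewrite Cmod_1.
    specialize (Ha k); lra.
  - apply Rmult_le_compat; auto using Cmod_ge_0.
    eapply Rle_trans; [exact HE|].
    rewrite <- (Rmult_1_r (exp E)) at 1; apply Rmult_le_compat_l; [lra|].
    specialize (Mp k); lra. }
assert (Hsum : forall k, Cmod (Cprod' a a' (S k)) <= sum_n M k * exp (sum_n M k)).
{ induction k as [|k IH].
  - rewrite sum_O; rewrite <- (Rplus_0_l (M O)); apply Hstep; simpl; try lra.
    + rewrite Cmod_1, exp_0; lra.
    + rewrite Cmod_0; lra.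
  - rewrite sum_Sn; apply Hstep; auto.
    + clear IH; induction k as [|k IH]; [now rewrite sum_O|].
      rewrite sum_Sn; now apply Rplus_le_le_0_compat.
    + now apply Cmod_Cprod_sum. }
assert (Hs0 := sum_n_le_Series M O HM Mp); rewrite sum_O in Hs0.
assert (Hp0 := Mp O).
destruct n as [|n].
- simpl; rewrite Cmod_0; apply Rmult_le_pos; [lra|left; apply exp_pos].
- eapply Rle_trans; [apply Hsum|].
  assert (Hs := sum_n_le_Series M n HM Mp).
  assert (H0 : 0 <= exp (sum_n M n)) by (left; apply exp_pos).
  apply Rle_trans with (Series M * exp (sum_n M n)).
  + now apply Rmult_le_compat_r.
  + apply Rmult_le_compat_l; [lra|now apply exp_mono].
Qed.

(** The derivative of the series is the limit of the derivatives of the partial products.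
    At t these are the partial products times the partial sums of a' / (1 + a). *)
Lemma is_Cderive_Cinfprod (a a' : nat -> R -> C) (M M' : nat -> R) (t d : R) :
  0 < d -> ex_series M ->
  (forall n s, Rabs (s - t) < d -> is_Cderive (a n) s (a' n s)) ->
  (forall n s, Rabs (s - t) < d -> Cmod (a n s) <= M n) ->
  (forall n s, Rabs (s - t) < d -> Cmod (a' n s) <= M n) ->
  (forall n, (1 + a n t)%C <> 0%C) ->
  ex_series M' -> (forall n, Cmod (a' n t / (1 + a n t))%C <= M' n) ->
  is_Cderive (fun s => Cinfprod (fun n => a n s)) t
    (Cinfprod (fun n => a n t) * CSeries (fun n => a' n t / (1 + a n t)))%C.
Proof.
intros Hd HM Hder Ha Ha' Hnz HM' Hlog.
assert (Ht : Rabs (t - t) < d) by (rewrite Rminus_diag, Rabs_R0; exact Hd).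
set (f' := fun n s => (Cprod' (fun k => a k s) (fun k => a' k s) n * a n s
                       + Cprod (fun k => a k s) n * a' n s)%C).
set (E := exp (Series M)).
assert (HE : 0 < E) by apply exp_pos.
assert (Hf' : forall n s, Rabs (s - t) < d ->
  Cmod (f' n s) <= (Series M * E + E) * M n).
{ intros n s Hs; unfold f'.
  eapply Rle_trans; [apply Cmod_triangle|]; rewrite !Cmod_mult, Rmult_plus_distr_r.
  apply Rplus_le_compat; apply Rmult_le_compat; auto using Cmod_ge_0.
  - apply Cmod_Cprod'_le; auto.
  - apply Cmod_Cprod_le; auto. }
assert (HME : forall c, ex_series (fun n => c * M n)).
{ intros c; now apply (ex_series_scal_l (V := R_NormedModule)). }
assert (HS : is_Cderive (fun s => CSeries (fun n => Cprod (fun k => a k s) n * a n s)%C) t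
               (CSeries (fun n => f' n t))).
{ apply (is_Cderive_CSeries (fun n s => Cprod (fun k => a k s) n * a n s)%C f'
    (fun n => E * M n) (fun n => (Series M * E + E) * M n) t d); auto.
  - intros n s Hs; unfold f'.
    apply (is_Cderive_mult (fun s => Cprod (fun k => a k s) n) (a n)); auto.
    apply (is_Cderive_Cprod a (fun k => a' k s)); auto.
  - intros n s Hs; apply (Cmod_Cprod_term (fun k => a k s)); auto. }
assert (Hval : CSeries (fun n => f' n t)
  = (Cinfprod (fun n => a n t) * CSeries (fun n => a' n t / (1 + a n t)))%C).
{ assert (L1 : is_Clim_seq (Cprod' (fun k => a k t) (fun k => a' k t))
                 (0 + CSeries (fun n => f' n t))%C).
  { apply (is_Clim_seq_partial_sums (Cprod' (fun k => a k t) (fun k => a' k t))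
      (fun n => f' n t) (fun n => (Series M * E + E) * M n)); auto.
    intros n; unfold f'; simpl; ring. }
  set (L := fix L (n : nat) : C := match n with O => 0%C
            | S m => (L m + a' m t / (1 + a m t))%C end).
  assert (L2 : is_Clim_seq L (0 + CSeries (fun n => a' n t / (1 + a n t)))%C).
  { apply (is_Clim_seq_partial_sums L (fun n => a' n t / (1 + a n t))%C M'); auto. }
  assert (L3 := is_Clim_seq_mult _ _ _ _
    (is_Clim_seq_Cprod (fun n => a n t) M HM (fun n => Ha n t Ht)) L2).
  rewrite Cplus_0_l in L1, L3.
  apply (is_Clim_seq_unique _ _ _ L1); revert L3; apply is_Clim_seq_ext.
  induction n as [|n IH]; simpl; [ring|].
  rewrite <- IH; field; apply Hnz. }
rewrite <- Hval.
now apply is_Cderive_plus_l.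
Qed.

(** * Coefficients of the finite triple product *)

Ltac close_nonzero :=
  match goal with
  | D : ?x <> 0 |- ?y <> 0 =>
    let H := fresh in intro H; apply D; transitivity y; [ring|exact H]
  end.

Section Cauchy.
Variables (q : R) (m : nat).
Hypothesis Hq : 0 < q < 1.

(** Up to sign these are q^(n^2 + m n) times the quotient, by its value at n = 0, of the
    Gaussian binomial coefficient [2N + m, N + m + n] in base q^2.  The truncated
    subtraction N - n makes them vanish for n > N. *)
Fixpoint cauchy_coeff (N n : nat) : R :=
  match n with
  | O => 1
  | S n => - cauchy_coeff N n * q ^ (2 * n + 1 + m)
           * ((1 - q ^ (2 * (N - n))) / (1 - q ^ (2 * (N + m + 1 + n))))
  end.

Lemma cauchy_coeff_S N n :
  cauchy_coeff N (S n) = - cauchy_coeff N n * q ^ (2 * n + 1 + m)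
           * ((1 - q ^ (2 * (N - n))) / (1 - q ^ (2 * (N + m + 1 + n)))).
Proof. reflexivity. Qed.

(** The number g for which the factor number N of the product is
    1 - 2 g cos(2 pi u) + g^2. *)
Definition factor_nome (N : nat) : R := q ^ (2 * N + 1 + m).

(** The quotient of the central Gaussian binomials [2N + 2 + m, N + 1 + m] and
    [2N + m, N + m]: the price of normalising the coefficient n = 0 to 1. *)
Definition cauchy_ratio (N : nat) : R :=
  (1 - q ^ (2 * (2 * N + m + 1))) * (1 - q ^ (2 * (2 * N + m + 2)))
  / ((1 - q ^ (2 * (N + 1))) * (1 - q ^ (2 * (N + m + 1)))).

Lemma pow_bounds k : 0 < q ^ k <= 1.
Proof.
split; [apply pow_lt; lra|].
induction k as [|k IH]; simpl; [lra|].
assert (0 < q ^ k) by (apply pow_lt; lra); nra.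
Qed.

Lemma pow_lt_1 k : (0 < k)%nat -> q ^ k < 1.
Proof.
destruct k as [|k]; [lia|intros _; simpl].
generalize (pow_bounds k); nra.
Qed.

Lemma one_minus_pow_neq_0 k : (0 < k)%nat -> 1 - q ^ k <> 0.
Proof. intros H; generalize (pow_lt_1 k H); lra. Qed.

Lemma cauchy_coeff_eq_0 N n : (N < n)%nat -> cauchy_coeff N n = 0.
Proof.
induction n as [|n IH]; [lia|intros H; rewrite cauchy_coeff_S].
destruct (Nat.eq_dec N n) as [->|Hn].
- rewrite Nat.sub_diag, Nat.mul_0_r; simpl; lra.
- rewrite IH by lia; ring.
Qed.

Lemma Rabs_cauchy_coeff_le N n : Rabs (cauchy_coeff N n) <= q ^ (n * n + m * n).
Proof.
induction n as [|n IH].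
- rewrite !Nat.mul_0_r; simpl; rewrite Rabs_R1; lra.
- rewrite cauchy_coeff_S, !Rabs_mult, Rabs_Ropp.
  replace (S n * S n + m * S n)%nat with ((n * n + m * n) + (2 * n + 1 + m))%nat by lia.
  rewrite (pow_add q (n * n + m * n)).
  assert (H1 := pow_bounds (2 * n + 1 + m)).
  assert (H2 := pow_bounds (2 * (N - n))).
  assert (H3 := pow_lt_1 (2 * (N + m + 1 + n)) ltac:(lia)).
  assert (H4 : q ^ (2 * (N + m + 1 + n)) <= q ^ (2 * (N - n))).
  { replace (2 * (N + m + 1 + n))%nat
      with (2 * (N - n) + (2 * (N + m + 1 + n) - 2 * (N - n)))%nat by lia.
    rewrite pow_add.
    generalize (pow_bounds (2 * (N + m + 1 + n) - 2 * (N - n))); nra. }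
  rewrite (Rabs_pos_eq (q ^ _)) by lra.
  assert (H5 : 0 <= (1 - q ^ (2 * (N - n))) / (1 - q ^ (2 * (N + m + 1 + n))) <= 1).
  { split; [apply Rdiv_le_0_compat; lra|apply Rle_div_l; lra]. }
  rewrite (Rabs_pos_eq (_ / _)) by lra.
  rewrite <- (Rmult_1_r (q ^ (n * n + m * n) * _)).
  apply Rmult_le_compat; try lra.
  + apply Rmult_le_pos; [apply Rabs_pos|lra].
  + apply Rmult_le_compat_r; lra.
Qed.

Lemma is_lim_seq_pow_shift k j : is_lim_seq (fun N => q ^ (2 * (N + k - j))) 0.
Proof.
apply is_lim_seq_incr_n with j.
apply is_lim_seq_ext with (fun N => q ^ (2 * k) * (q ^ 2) ^ N).
{ intros N; rewrite <- pow_mult, <- pow_add; f_equal; lia. }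
replace (Finite 0) with (Finite (q ^ (2 * k) * 0)) by (f_equal; ring).
apply is_lim_seq_mult'; [apply is_lim_seq_const|].
apply is_lim_seq_geom; rewrite Rabs_pos_eq; generalize (pow_lt_1 2); 
  generalize (pow_bounds 2); intros; try lra; apply H0; lia.
Qed.

Lemma is_lim_seq_cauchy_coeff n :
  is_lim_seq (fun N => cauchy_coeff N n) ((-1) ^ n * q ^ (n * n + m * n)).
Proof.
induction n as [|n IH].
- rewrite !Nat.mul_0_r; simpl; rewrite Rmult_1_r; apply is_lim_seq_const.
- replace (S n * S n + m * S n)%nat with ((n * n + m * n) + (2 * n + 1 + m))%nat by lia.
  rewrite (pow_add q (n * n + m * n)).
  replace ((-1) ^ S n * (q ^ (n * n + m * n) * q ^ (2 * n + 1 + m))) with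
   (- ((-1) ^ n * q ^ (n * n + m * n)) * q ^ (2 * n + 1 + m) * ((1 - 0) / (1 - 0)))
   by (simpl; field).
  apply is_lim_seq_ext with (fun N => - cauchy_coeff N n * q ^ (2 * n + 1 + m)
    * ((1 - q ^ (2 * (N - n))) / (1 - q ^ (2 * (N + m + 1 + n))))); [reflexivity|].
  apply is_lim_seq_mult'; [apply is_lim_seq_mult'|].
  + apply (is_lim_seq_opp (fun N => cauchy_coeff N n) (Finite _)), IH.
  + apply is_lim_seq_const.
  + apply is_lim_seq_div'; [| |lra]; apply is_lim_seq_minus'; try apply is_lim_seq_const.
    * apply is_lim_seq_ext with (fun N => q ^ (2 * (N + 0 - n))).
      { intros N; f_equal; lia. }
      apply is_lim_seq_pow_shift.
    * apply is_lim_seq_ext with (fun N => q ^ (2 * (N + (m + 1 + n) - 0))).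
      { intros N; f_equal; lia. }
      apply is_lim_seq_pow_shift.
Qed.

(** Going up along the diagonal shifts the indices of both products, so that all but
    boundary factors cancel.  Unlike a comparison of (N + 1, n) with (N, n), this has no
    exceptional case at n = N + 1, where both sides of the latter vanish. *)
Lemma cauchy_coeff_diagonal N n :
  cauchy_coeff (S N) (S n) =
  - q ^ (2 * n + 1 + m) * cauchy_coeff N n
  * ((1 - q ^ (2 * (N + 1))) * (1 - q ^ (2 * (N + m + 1)))
     / ((1 - q ^ (2 * (N + m + n + 1))) * (1 - q ^ (2 * (N + m + n + 2))))).
Proof.
induction n as [|n IH].
- rewrite !cauchy_coeff_S; simpl (cauchy_coeff _ 0).
  replace (S N - 0)%nat with (N + 1)%nat by lia.
  replace (S N + m + 1 + 0)%nat with (N + m + 0 + 2)%nat by lia.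
  replace (N + m + 0 + 1)%nat with (N + m + 1)%nat by lia.
  field; split; apply one_minus_pow_neq_0; lia.
- rewrite cauchy_coeff_S, IH, cauchy_coeff_S; clear IH.
  replace (S N - S n)%nat with (N - n)%nat by lia.
  replace (S N + m + 1 + S n)%nat with (N + m + S n + 2)%nat by lia.
  replace (N + m + 1 + n)%nat with (N + m + n + 1)%nat by lia.
  replace (N + m + S n + 1)%nat with (N + m + n + 2)%nat by lia.
  field; repeat split; apply one_minus_pow_neq_0; lia.
Qed.

(** Comparison of the coefficients of Z_(n+1) when the finite sum is multiplied by
    1 - 2 g c + g^2 and 2 c Z_n is expanded.  All terms are rational multiples of
    the coefficient (N, n), except that those with second index above N
    vanish. *)
Lemma cauchy_coeff_recurrence N n :
  cauchy_ratio N * cauchy_coeff (S N) (S n) =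
  (1 + factor_nome N ^ 2) * cauchy_coeff N (S n)
  - factor_nome N * (cauchy_coeff N (S (S n)) + cauchy_coeff N n).
Proof.
rewrite cauchy_coeff_diagonal; unfold cauchy_ratio, factor_nome.
destruct (Nat.lt_ge_cases N n) as [Hn|Hn].
{ rewrite !(cauchy_coeff_eq_0 N) by lia; ring. }
assert (D1 := one_minus_pow_neq_0 (2 * (N + 1)) ltac:(lia)).
assert (D2 := one_minus_pow_neq_0 (2 * (N + m + 1)) ltac:(lia)).
assert (D3 := one_minus_pow_neq_0 (2 * (N + m + n + 1)) ltac:(lia)).
assert (D4 := one_minus_pow_neq_0 (2 * (N + m + n + 2)) ltac:(lia)).
destruct (Nat.eq_dec N n) as [->|Hne].
{ rewrite (cauchy_coeff_eq_0 n (S n)), (cauchy_coeff_eq_0 n (S (S n))) by lia.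
  replace (2 * n + m + 1)%nat with (n + m + n + 1)%nat by lia.
  replace (2 * n + m + 2)%nat with (n + m + n + 2)%nat by lia.
  field; repeat split; assumption. }
rewrite !cauchy_coeff_S.
replace (N + m + 1 + n)%nat with (N + m + n + 1)%nat by lia.
replace (N + m + 1 + S n)%nat with (N + m + n + 2)%nat by lia.
set (x := cauchy_coeff N n).
(* Here n < N.  With N = n + 1 + j, the identity is one of rational functions in q,
   q ^ j, q ^ n and q ^ m. *)
assert (Hlt : (S n <= N)%nat) by lia.
destruct (Nat.le_exists_sub (S n) N Hlt) as [j [-> _]].
replace (j + S n - n)%nat with (j + 1)%nat by lia.
replace (j + S n - S n)%nat with j by lia.
assert (E : forall a b c d, q ^ (2 * (a * j + b * n + c * m + d))
  = (q ^ j) ^ (2 * a) * (q ^ n) ^ (2 * b) * (q ^ m) ^ (2 * c) * q ^ (2 * d)).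
{ intros a b c d; rewrite <- !pow_mult, <- !pow_add; f_equal; lia. }
assert (E' : forall a b c d, q ^ (a * j + b * n + c * m + d)
  = (q ^ j) ^ a * (q ^ n) ^ b * (q ^ m) ^ c * q ^ d).
{ intros a b c d; rewrite <- !pow_mult, <- !pow_add; f_equal; lia. }
replace (j + S n + 1)%nat with (1 * j + 1 * n + 0 * m + 2)%nat in * by lia.
replace (j + S n + m + 1)%nat with (1 * j + 1 * n + 1 * m + 2)%nat in * by lia.
replace (j + S n + m + n + 1)%nat with (1 * j + 2 * n + 1 * m + 2)%nat in * by lia.
replace (j + S n + m + n + 2)%nat with (1 * j + 2 * n + 1 * m + 3)%nat in * by lia.
replace (2 * (j + S n) + m + 1)%nat with (2 * j + 2 * n + 1 * m + 3)%nat by lia.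
replace (2 * (j + S n) + m + 2)%nat with (2 * j + 2 * n + 1 * m + 4)%nat by lia.
replace (2 * n + 1 + m)%nat with (0 * j + 2 * n + 1 * m + 1)%nat by lia.
replace (2 * S n + 1 + m)%nat with (0 * j + 2 * n + 1 * m + 3)%nat by lia.
replace (2 * (j + S n) + 1 + m)%nat with (2 * j + 2 * n + 1 * m + 3)%nat by lia.
replace (j + 1)%nat with (1 * j + 0 * n + 0 * m + 1)%nat by lia.
replace (q ^ (2 * j)) with (q ^ (2 * (1 * j + 0 * n + 0 * m + 0))) by (f_equal; lia).
rewrite !E in *; rewrite !E'.
clearbody x; clear E E' Hn Hne Hlt.
set (J := q ^ j) in *; set (P := q ^ n) in *; set (u := q ^ m) in *.
clearbody J P u.
simpl Nat.mul in *.
field; repeat split; close_nonzero.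
Qed.

(** The same comparison for Z_0, where 2 c Z_0 and 2 c Z_1 contribute according
    to the first two clauses of a trigonometric sequence. *)
Lemma cauchy_coeff_recurrence_0 N : (m = 0 \/ m = 1)%nat ->
  cauchy_ratio N = 1 + factor_nome N ^ 2 + INR m * factor_nome N
                   - (2 - INR m) * factor_nome N * cauchy_coeff N 1.
Proof.
intros Hm; unfold cauchy_ratio, factor_nome; rewrite cauchy_coeff_S; simpl (cauchy_coeff _ 0).
assert (D1 := one_minus_pow_neq_0 (2 * (N + 1)) ltac:(lia)).
assert (D2 := one_minus_pow_neq_0 (2 * (N + m + 1)) ltac:(lia)).
replace (2 * 0 + 1 + m)%nat with (m + 1)%nat by lia.
replace (N - 0)%nat with N by lia.
replace (N + m + 1 + 0)%nat with (N + m + 1)%nat by lia.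
assert (E : forall a b, q ^ (2 * (a * N + b)) = (q ^ N) ^ (2 * a) * q ^ (2 * b)).
{ intros a b; rewrite <- !pow_mult, <- !pow_add; f_equal; lia. }
assert (E' : forall a b, q ^ (a * N + b) = (q ^ N) ^ a * q ^ b).
{ intros a b; rewrite <- !pow_mult, <- !pow_add; f_equal; lia. }
replace (q ^ (2 * N)) with (q ^ (2 * (1 * N + 0))) by (f_equal; lia).
destruct Hm as [-> | ->].
- replace (2 * N + 0 + 1)%nat with (2 * N + 1)%nat by lia.
  replace (2 * N + 0 + 2)%nat with (2 * N + 2)%nat by lia.
  replace (N + 0 + 1)%nat with (N + 1)%nat in * by lia.
  replace (2 * N + 1 + 0)%nat with (2 * N + 1)%nat in * by lia.
  replace (N + 1)%nat with (1 * N + 1)%nat in * by lia.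
  rewrite !E in *; rewrite !E'.
  set (P := q ^ N) in *; clearbody P; simpl in *; field; repeat split; close_nonzero.
- replace (2 * N + 1 + 1)%nat with (2 * N + 2)%nat by lia.
  replace (2 * N + 1 + 2)%nat with (2 * N + 3)%nat by lia.
  replace (N + 1 + 1)%nat with (1 * N + 2)%nat in * by lia.
  replace (N + 1)%nat with (1 * N + 1)%nat in * by lia.
  rewrite !E in *; rewrite !E'.
  set (P := q ^ N) in *; clearbody P; simpl in *; field; repeat split; close_nonzero.
Qed.

Lemma cauchy_ratio_neq_0 N : cauchy_ratio N <> 0.
Proof.
unfold cauchy_ratio, Rdiv; apply Rmult_integral_contrapositive; split.
- apply Rmult_integral_contrapositive; split; apply one_minus_pow_neq_0; lia.
- apply Rinv_neq_0_compat, Rmult_integral_contrapositive; split;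
    apply one_minus_pow_neq_0; lia.
Qed.

End Cauchy.

(** * From finite products to theta sums *)

(** The product-to-sum relations of 1, 2 cos x, 2 cos 2x, ... (m = 0) and of
    sin(x/2), sin(3x/2), ... (m = 1), where c = cos x.  The initial clauses encode the
    reflection n -> - n - m of the two-sided theta series. *)
Definition trig_sequence (m : nat) (c : C) (Z : nat -> C) : Prop :=
  (2 * c * Z 0%nat = Z 1%nat - INR m * Z 0%nat)%C /\
  (2 * c * Z 1%nat = Z 2%nat + (2 - INR m) * Z 0%nat)%C /\
  (forall n, 2 * c * Z (S (S n)) = Z (S (S (S n))) + Z (S n))%C.

Section Quotient.
Variables (q : R) (m : nat).
Hypothesis Hq : 0 < q < 1.
Hypothesis Hm : (m = 0 \/ m = 1)%nat.

Definition finite_theta (Z : nat -> C) (N : nat) : C :=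
  CSeries (fun n => cauchy_coeff q m N n * Z n)%C.

Definition theta_sum (Z : nat -> C) : C :=
  CSeries (fun n => RtoC ((-1) ^ n * q ^ (n * n + m * n)) * Z n)%C.

Section Step.
Variables (c : C) (Z : nat -> C) (M : nat -> R).
Hypothesis HZ : trig_sequence m c Z.
Hypothesis HM : ex_series M.
Hypothesis HZM : forall n, q ^ (n * n + m * n) * Cmod (Z n) <= M n.

Lemma Cmod_cauchy_coeff_term_le N n : Cmod (cauchy_coeff q m N n * Z n)%C <= M n.
Proof.
rewrite Cmod_mult, Cmod_R; eapply Rle_trans; [|apply HZM].
apply Rmult_le_compat_r; [apply Cmod_ge_0|now apply Rabs_cauchy_coeff_le].
Qed.

(** Multiplication by 2 c redistributes each term to its neighbours; in a partial sum
    only the last two indices are left over. *)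
Lemma Csum_cauchy_coeff N L :
  (cauchy_ratio q m N * Csum (fun n => cauchy_coeff q m (S N) n * Z n) (S (S L))
   = (1 - 2 * factor_nome q m N * c + factor_nome q m N ^ 2)
       * Csum (fun n => cauchy_coeff q m N n * Z n) (S (S L))
     + factor_nome q m N * (cauchy_coeff q m N (S L) * Z (S (S L))
                            - cauchy_coeff q m N (S (S L)) * Z (S L)))%C.
Proof.
destruct HZ as (Z0 & Z1 & Z2).
assert (R0 : (RtoC (cauchy_ratio q m N) = 1 + factor_nome q m N ^ 2 + INR m * factor_nome q m N
              - (2 - INR m) * factor_nome q m N * cauchy_coeff q m N 1)%C).
{ rewrite <- RtoC_pow, <- RtoC_minus, <- !RtoC_mult, <- !RtoC_plus, <- RtoC_minus.
  f_equal; now apply cauchy_coeff_recurrence_0. }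
assert (Rn : forall n, (RtoC (cauchy_ratio q m N) * cauchy_coeff q m (S N) (S n)
  = (1 + factor_nome q m N ^ 2) * cauchy_coeff q m N (S n)
    - factor_nome q m N * (cauchy_coeff q m N (S (S n)) + cauchy_coeff q m N n))%C).
{ intros n; rewrite <- RtoC_pow, <- !RtoC_plus, <- !RtoC_mult, <- RtoC_minus.
  f_equal; now apply cauchy_coeff_recurrence. }
induction L as [|L IH].
- specialize (Rn O); cbn [Csum].
  change (cauchy_coeff q m (S N) 0) with 1; change (cauchy_coeff q m N 0) with 1 in *.
  set (g := RtoC (factor_nome q m N)) in *.
  set (e1 := RtoC (cauchy_coeff q m N 1)) in *; set (e2 := RtoC (cauchy_coeff q m N 2)) in *.
  transitivity (cauchy_ratio q m N * Z 0%nat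
    + (cauchy_ratio q m N * cauchy_coeff q m (S N) 1) * Z 1%nat)%C; [ring|].
  rewrite Rn, R0.
  transitivity ((1 + g ^ 2) * (Z 0%nat + e1 * Z 1%nat)
    - g * (2 * c * Z 0%nat) - g * e1 * (2 * c * Z 1%nat)
    + g * (e1 * Z 2%nat - e2 * Z 1%nat))%C; [|ring].
  rewrite Z0, Z1; ring.
- change (Csum ?f (S (S (S L)))) with (Csum f (S (S L)) + f (S (S L)))%C.
  cbv beta; rewrite Cmult_plus_distr_l, IH; clear IH.
  rewrite (Cmult_assoc _ _ (Z (S (S L)))), (Rn (S L)).
  set (X := Csum _ _); set (g := RtoC (factor_nome q m N)).
  transitivity ((1 - 2 * g * c + g ^ 2) * X + g * cauchy_coeff q m N (S L) * Z (S (S L))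
    - g * cauchy_coeff q m N (S (S L)) * Z (S L)
    + ((1 + g ^ 2) * cauchy_coeff q m N (S (S L))
       - g * (cauchy_coeff q m N (S (S (S L))) + cauchy_coeff q m N (S L)))
      * Z (S (S L)))%C; [ring|].
  transitivity ((1 + g ^ 2) * (X + cauchy_coeff q m N (S (S L)) * Z (S (S L)))
    - g * (2 * c) * X - g * cauchy_coeff q m N (S (S L)) * (2 * c * Z (S (S L)))
    + g * (cauchy_coeff q m N (S (S L)) * Z (S (S (S L)))
           - cauchy_coeff q m N (S (S (S L))) * Z (S (S L))))%C; [|ring].
  rewrite Z2; ring.
Qed.

(** For L >= N the boundary terms of the partial sums vanish. *)
Lemma finite_theta_step N :
  (cauchy_ratio q m N * finite_theta Z (S N)
   = (1 - 2 * factor_nome q m N * c + factor_nome q m N ^ 2) * finite_theta Z N)%C.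
Proof.
assert (HL : forall N, is_Clim_seq
  (fun L => Csum (fun n => cauchy_coeff q m N n * Z n)%C (L + 2)) (finite_theta Z N)).
{ intros K; apply is_Clim_seq_incr_n, is_Clim_seq_Csum with M; auto.
  apply Cmod_cauchy_coeff_term_le. }
assert (H1 := is_Clim_seq_mult _ _ _ _
  (is_Clim_seq_const (cauchy_ratio q m N)) (HL (S N))).
assert (H2 := is_Clim_seq_mult _ _ _ _
  (is_Clim_seq_const (1 - 2 * factor_nome q m N * c + factor_nome q m N ^ 2)%C) (HL N)).
apply (is_Clim_seq_unique _ _ _ H1).
revert H2; apply is_Clim_seq_ext_loc with N; intros L HNL.
replace (L + 2)%nat with (S (S L)) by lia.
rewrite Csum_cauchy_coeff, !(cauchy_coeff_eq_0 q m N) by lia; ring.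
Qed.

Lemma finite_theta_0 : finite_theta Z 0 = Z 0%nat.
Proof.
assert (H := is_Clim_seq_incr_n _ 1 _
  (is_Clim_seq_Csum (fun n => cauchy_coeff q m 0 n * Z n)%C M HM (Cmod_cauchy_coeff_term_le O))).
apply (is_Clim_seq_unique _ _ _ H).
apply is_Clim_seq_ext with (fun _ => Z 0%nat); [|apply is_Clim_seq_const].
intros n; rewrite Nat.add_1_r.
induction n as [|n IH]; [simpl; ring|].
change (Csum ?f (S (S n))) with (Csum f (S n) + f (S n))%C.
rewrite <- IH, cauchy_coeff_eq_0 by lia; ring.
Qed.

Lemma is_Clim_seq_finite_theta : is_Clim_seq (finite_theta Z) (theta_sum Z).
Proof.
unfold finite_theta, theta_sum.
apply CSeries_dominated with M; auto using Cmod_cauchy_coeff_term_le.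
- intros n; rewrite Cmod_mult, Cmod_R, Rabs_mult, pow_1_abs, Rmult_1_l.
  rewrite Rabs_pos_eq; [apply HZM|left; apply pow_lt; lra].
- intros n; apply is_Clim_seq_mult; [|apply is_Clim_seq_const].
  split; simpl; [now apply is_lim_seq_cauchy_coeff|apply is_lim_seq_const].
Qed.

End Step.

(** At level N, [finite_theta_step] for Z and for Z1 has the same scalar; hence the two
    finite sums differ by the partial product.  Then N tends to infinity. *)
Lemma theta_sum_quotient (c : C) (Z Z1 : nat -> C) (M : nat -> R) (a : nat -> C)
  (Ma : nat -> R) :
  trig_sequence m c Z -> trig_sequence m 1 Z1 -> Z1 0%nat = 1%C ->
  ex_series M ->
  (forall n, q ^ (n * n + m * n) * Cmod (Z n) <= M n) ->
  (forall n, q ^ (n * n + m * n) * Cmod (Z1 n) <= M n) ->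
  (forall k, a k = 2 * factor_nome q m k * (1 - c) / (1 - factor_nome q m k) ^ 2)%C ->
  ex_series Ma -> (forall k, Cmod (a k) <= Ma k) ->
  (theta_sum Z = Z 0%nat * Cinfprod a * theta_sum Z1)%C.
Proof.
intros HZ HZ1 HZ10 HM HZM HZ1M Ha HMa HaM.
assert (Hfin : forall N,
  (finite_theta Z N = Z 0%nat * Cprod a N * finite_theta Z1 N)%C).
{ induction N as [|N IH].
  - rewrite (finite_theta_0 Z M), (finite_theta_0 Z1 M) by assumption.
    rewrite HZ10; simpl; ring.
  - assert (S1 := finite_theta_step c Z M HZ HM HZM N).
    assert (S2 := finite_theta_step 1 Z1 M HZ1 HM HZ1M N).
    assert (Hg : (1 - factor_nome q m N)%C <> 0%C).
    { unfold factor_nome; rewrite <- RtoC_minus; intros H; apply RtoC_inj in H; revert H.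
      apply (one_minus_pow_neq_0 q Hq); lia. }
    assert (HK : RtoC (cauchy_ratio q m N) <> 0%C).
    { intros H; apply RtoC_inj in H; revert H; now apply cauchy_ratio_neq_0. }
    assert (X1 : (finite_theta Z (S N) = / cauchy_ratio q m N
       * ((1 - 2 * factor_nome q m N * c + factor_nome q m N ^ 2) * finite_theta Z N))%C).
    { rewrite <- S1; field; exact HK. }
    assert (X2 : (finite_theta Z1 (S N) = / cauchy_ratio q m N
       * ((1 - 2 * factor_nome q m N * 1 + factor_nome q m N ^ 2) * finite_theta Z1 N))%C).
    { rewrite <- S2; field; exact HK. }
    rewrite X1, X2, IH; simpl Cprod; rewrite Ha; field; split; assumption. }
apply is_Clim_seq_unique with (finite_theta Z).
- now apply is_Clim_seq_finite_theta with M.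
- apply is_Clim_seq_ext with (1 := fun N => eq_sym (Hfin N)).
  apply is_Clim_seq_mult; [apply is_Clim_seq_mult|].
  + apply is_Clim_seq_const.
  + now apply is_Clim_seq_Cprod with Ma.
  + now apply is_Clim_seq_finite_theta with M.
Qed.

End Quotient.

(** * Complex sine and cosine *)

Lemma Cexp_plus (z w : C) : Cexp (z + w) = (Cexp z * Cexp w)%C.
Proof.
unfold Cexp, Re, Im; simpl; rewrite exp_plus, cos_plus, sin_plus.
apply injective_projections; simpl; ring.
Qed.

Lemma Cexp_0 : Cexp 0 = 1%C.
Proof.
unfold Cexp; simpl; rewrite exp_0, cos_0, sin_0.
apply injective_projections; simpl; ring.
Qed.

Lemma Cmod_Cexp (z : C) : Cmod (Cexp z) = exp (Re z).
Proof.
unfold Cexp, Cmod; simpl.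
transitivity (sqrt (Rsqr (exp (Re z)))); [f_equal|apply sqrt_Rsqr; left; apply exp_pos].
generalize (sin2_cos2 (Im z)); unfold Rsqr; intros H.
transitivity (exp (Re z) * exp (Re z) * (sin (Im z) * sin (Im z) + cos (Im z) * cos (Im z)));
  [ring|rewrite H; ring].
Qed.

Lemma Cexp_opp_mult (z : C) : (Cexp z * Cexp (- z) = 1)%C.
Proof. rewrite <- Cexp_plus, Cplus_opp_r; apply Cexp_0. Qed.

Lemma C2_neq_0 : RtoC 2 <> 0%C.
Proof. intros H; apply RtoC_inj in H; lra. Qed.

Ltac Cnz := repeat split; auto using Ci_nz, C2_neq_0, Cmult_neq_0.

Lemma Ccos_0 : Ccos 0 = 1%C.
Proof.
unfold Ccos; rewrite Cmult_0_r, Copp_0, Cexp_0; field; Cnz.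
Qed.

Lemma Ccos_Ccos (x y : C) : (2 * Ccos x * Ccos y = Ccos (y + x) + Ccos (y - x))%C.
Proof.
unfold Ccos.
replace (Ci * (y + x))%C with (Ci * y + Ci * x)%C by ring.
replace (- (Ci * y + Ci * x))%C with (- (Ci * y) + - (Ci * x))%C by ring.
replace (Ci * (y - x))%C with (Ci * y + - (Ci * x))%C by ring.
replace (- (Ci * y + - (Ci * x)))%C with (- (Ci * y) + Ci * x)%C by ring.
rewrite !Cexp_plus; field; Cnz.
Qed.

Lemma Ccos_Csin (x y : C) : (2 * Ccos x * Csin y = Csin (y + x) + Csin (y - x))%C.
Proof.
unfold Ccos, Csin.
replace (Ci * (y + x))%C with (Ci * y + Ci * x)%C by ring.
replace (- (Ci * y + Ci * x))%C with (- (Ci * y) + - (Ci * x))%C by ring.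
replace (Ci * (y - x))%C with (Ci * y + - (Ci * x))%C by ring.
replace (- (Ci * y + - (Ci * x)))%C with (- (Ci * y) + Ci * x)%C by ring.
rewrite !Cexp_plus; field; Cnz.
Qed.

Lemma Csin_opp (x : C) : Csin (- x) = (- Csin x)%C.
Proof.
unfold Csin; replace (Ci * - x)%C with (- (Ci * x))%C by ring.
replace (- - (Ci * x))%C with (Ci * x)%C by ring; field; Cnz.
Qed.

Lemma Ccos_double (x : C) : Ccos (2 * x) = (1 - 2 * Csin x ^ 2)%C.
Proof.
set (e := Cexp (Ci * x)); set (f := Cexp (- (Ci * x))).
assert (Hd : (e - f = 2 * Ci * Csin x)%C) by (unfold Csin; fold e f; field; Cnz).
assert (Hi : (Ci * Ci = - (1))%C) by (apply injective_projections; simpl; ring).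
assert (H : (e * f = 1)%C) by apply Cexp_opp_mult.
unfold Ccos.
replace (Ci * (2 * x))%C with (Ci * x + Ci * x)%C by ring.
replace (- (Ci * x + Ci * x))%C with (- (Ci * x) + - (Ci * x))%C by ring.
rewrite !Cexp_plus; fold e f.
replace (e * e + f * f)%C with (2 * (e * f) + (e - f) * (e - f))%C by ring.
rewrite H, Hd.
transitivity (1 + 2 * (Ci * Ci) * Csin x ^ 2)%C; [field; Cnz|rewrite Hi; ring].
Qed.

Lemma Cexp_Ci_real (x : R) : Cexp (Ci * x)%C = (cos x, sin x).
Proof.
unfold Cexp; simpl.
replace (0 * x - 1 * 0) with 0 by ring; replace (0 * 0 + 1 * x) with x by ring.
rewrite exp_0; apply injective_projections; simpl; ring.
Qed.

Lemma Csin_RtoC (x : R) : Csin x = RtoC (sin x).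
Proof.
unfold Csin; replace (- (Ci * x))%C with (Ci * (- x)%R)%C by (rewrite RtoC_opp; ring).
rewrite !Cexp_Ci_real, cos_neg, sin_neg.
replace ((cos x, sin x) - (cos x, (- sin x)%R))%C with (2 * Ci * sin x)%C
  by (apply injective_projections; simpl; ring).
field; Cnz.
Qed.

Lemma Ccos_plus_PI (z : C) : Ccos (z + PI) = (- Ccos z)%C.
Proof.
unfold Ccos.
replace (Ci * (z + PI))%C with (Ci * z + Ci * PI)%C by ring.
replace (- (Ci * z + Ci * PI))%C with (- (Ci * z) + Ci * (- PI)%R)%C
  by (rewrite RtoC_opp; ring).
rewrite !Cexp_plus, !Cexp_Ci_real, cos_neg, sin_neg, cos_PI, sin_PI.
replace (-1, 0)%R with (RtoC (-1)) by reflexivity.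
replace (-1, -0)%R with (RtoC (-1)) by (unfold RtoC; f_equal; ring).
field; Cnz.
Qed.

Lemma Csin_plus_PI (z : C) : Csin (z + PI) = (- Csin z)%C.
Proof.
unfold Csin.
replace (Ci * (z + PI))%C with (Ci * z + Ci * PI)%C by ring.
replace (- (Ci * z + Ci * PI))%C with (- (Ci * z) + Ci * (- PI)%R)%C
  by (rewrite RtoC_opp; ring).
rewrite !Cexp_plus, !Cexp_Ci_real, cos_neg, sin_neg, cos_PI, sin_PI.
replace (-1, 0)%R with (RtoC (-1)) by reflexivity.
replace (-1, -0)%R with (RtoC (-1)) by (unfold RtoC; f_equal; ring).
field; Cnz.
Qed.

Lemma Csin_plus_PI2 (z : C) : Csin (z + PI / 2) = Ccos z.
Proof.
unfold Csin, Ccos.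
replace (PI / 2)%C with (RtoC (PI / 2)) by (apply RtoC_div; lra).
replace (Ci * (z + (PI / 2)%R))%C with (Ci * z + Ci * (PI / 2)%R)%C by ring.
replace (- (Ci * z + Ci * (PI / 2)%R))%C with (- (Ci * z) + Ci * (- (PI / 2))%R)%C
  by (rewrite RtoC_opp; ring).
rewrite !Cexp_plus, !Cexp_Ci_real, cos_neg, sin_neg, cos_PI2, sin_PI2.
change (0, 1) with Ci.
replace (0, -(1)) with (- Ci)%C by (unfold Ci, Copp; simpl; f_equal; ring).
field; Cnz.
Qed.

Lemma Cmod_Ccos_le_cosh (z : C) : Cmod (Ccos z) <= cosh (Im z).
Proof.
unfold Ccos; rewrite Cmod_div by apply C2_neq_0.
rewrite Cmod_R, Rabs_pos_eq by lra; unfold cosh.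
apply Rmult_le_compat_r; [lra|].
eapply Rle_trans; [apply Cmod_triangle|]; rewrite !Cmod_Cexp.
unfold Re, Im; simpl; right; rewrite Rplus_comm; f_equal; f_equal; ring.
Qed.

Lemma Cmod_Csin_le_cosh (z : C) : Cmod (Csin z) <= cosh (Im z).
Proof.
unfold Csin; rewrite Cmod_div.
2: { intros H; apply Cmult_neq_0 in H; auto using C2_neq_0, Ci_nz. }
rewrite Cmod_mult, Cmod_Ci, Cmod_R, Rabs_pos_eq, Rmult_1_r by lra; unfold cosh.
apply Rmult_le_compat_r; [lra|].
eapply Rle_trans; [apply Cmod_triangle|]; rewrite Cmod_opp, !Cmod_Cexp.
unfold Re, Im; simpl; right; rewrite Rplus_comm; f_equal; f_equal; ring.
Qed.

(** * Harmonics and summable majorants *)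

(** The functions of u in the series of theta4 (m = 0) and theta1 (m = 1). *)
Definition theta_harmonic (m : nat) (u : C) (n : nat) : C :=
  match m, n with
  | O, O => 1%C
  | O, S _ => (2 * Ccos (RtoC (2 * INR n * PI) * u))%C
  | _, _ => Csin (RtoC ((2 * INR n + 1) * PI) * u)
  end.

(** The harmonics at u = 0, after division by the first one: 1, 2, 2, ... for m = 0 and
    1, 3, 5, ... for m = 1. *)
Definition theta_weight (m n : nat) : R :=
  match n with O => 1 | S _ => 2 + INR m * (2 * INR n - 1) end.

Lemma trig_sequence_harmonic (m : nat) (u : C) :
  (m = 0 \/ m = 1)%nat -> trig_sequence m (Ccos (2 * PI * u)) (theta_harmonic m u).
Proof.
intros [-> | ->]; unfold trig_sequence; cbn [theta_harmonic].
- repeat split.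
  + change (INR 0) with 0; change (INR 1) with 1.
    replace (RtoC (2 * 1 * PI)) with (2 * PI)%C by (rewrite !RtoC_mult; ring); ring.
  + change (INR 0) with 0; change (INR 1) with 1; change (INR 2) with 2.
    replace (RtoC (2 * 1 * PI)) with (2 * PI)%C by (rewrite !RtoC_mult; ring).
    replace (RtoC (2 * 2 * PI)) with (2 * PI + 2 * PI)%C by (rewrite !RtoC_mult; ring).
    transitivity (2 * (2 * Ccos (2 * PI * u) * Ccos (2 * PI * u)))%C; [ring|].
    rewrite Ccos_Ccos.
    replace (2 * PI * u - 2 * PI * u)%C with (RtoC 0) by ring; rewrite Ccos_0.
    replace ((2 * PI + 2 * PI) * u)%C with (2 * PI * u + 2 * PI * u)%C by ring; ring.
  + intros n.
    set (x := (2 * PI * u)%C).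
    set (y := (RtoC (2 * INR (S (S n)) * PI) * u)%C).
    transitivity (2 * (2 * Ccos x * Ccos y))%C; [ring|].
    rewrite Ccos_Ccos.
    replace (RtoC (2 * INR (S (S (S n))) * PI) * u)%C with (y + x)%C.
    2: { unfold x, y; rewrite (S_INR (S (S n))), !RtoC_mult, RtoC_plus; ring. }
    replace (RtoC (2 * INR (S n) * PI) * u)%C with (y - x)%C.
    2: { unfold x, y; rewrite (S_INR (S n)), !RtoC_mult, RtoC_plus; ring. }
    ring.
- repeat split.
  + change (INR 0) with 0; change (INR 1) with 1.
    replace (RtoC ((2 * 0 + 1) * PI)) with (RtoC PI) by (f_equal; ring).
    replace (RtoC ((2 * 1 + 1) * PI)) with (RtoC PI + 2 * PI)%C
      by (rewrite !RtoC_mult, RtoC_plus, RtoC_mult; ring).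
    rewrite Ccos_Csin.
    replace (PI * u - 2 * PI * u)%C with (- (PI * u))%C by ring; rewrite Csin_opp.
    replace ((PI + 2 * PI) * u)%C with (PI * u + 2 * PI * u)%C by ring; ring.
  + change (INR 0) with 0; change (INR 1) with 1; change (INR 2) with 2.
    rewrite Ccos_Csin.
    replace (RtoC ((2 * 0 + 1) * PI) * u)%C with (RtoC ((2 * 1 + 1) * PI) * u - 2 * PI * u)%C.
    2: { rewrite !RtoC_mult, !RtoC_plus, !RtoC_mult; ring. }
    replace (RtoC ((2 * 2 + 1) * PI) * u)%C with (RtoC ((2 * 1 + 1) * PI) * u + 2 * PI * u)%C.
    2: { rewrite !RtoC_mult, !RtoC_plus, !RtoC_mult; ring. }
    ring.
  + intros n; rewrite Ccos_Csin; f_equal; f_equal.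
    * rewrite (S_INR (S (S n))), !RtoC_mult, !RtoC_plus, !RtoC_mult, RtoC_plus; ring.
    * rewrite (S_INR (S n)), !RtoC_mult, !RtoC_plus, !RtoC_mult, RtoC_plus; ring.
Qed.

Lemma trig_sequence_weight (m : nat) :
  (m = 0 \/ m = 1)%nat -> trig_sequence m 1 (fun n => RtoC (theta_weight m n)).
Proof.
intros Hm; unfold trig_sequence; cbn [theta_weight]; repeat split; [| |intros n];
  rewrite ?S_INR; simpl (INR 0);
  rewrite <- ?RtoC_mult, <- ?RtoC_minus, <- ?RtoC_mult, <- ?RtoC_plus, <- ?RtoC_minus;
  f_equal; destruct Hm as [-> | ->]; simpl; ring.
Qed.

(** The harmonics of theta4 at u = 1/2, that is, of theta3 at 0. *)
Lemma trig_sequence_alternating_weight :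
  trig_sequence 0 (-1) (fun n => RtoC ((-1) ^ n * theta_weight 0 n)).
Proof.
unfold trig_sequence; cbn [theta_weight]; repeat split; [| |intros n];
  simpl (INR 0);
  rewrite <- ?RtoC_mult, <- ?RtoC_minus, <- ?RtoC_mult, <- ?RtoC_plus, <- ?RtoC_minus;
  f_equal; simpl; ring.
Qed.

Lemma Cmod_theta_harmonic_le (m n : nat) (u : C) :
  Cmod (theta_harmonic m u n) <= 2 * exp ((2 * PI * Rabs (Im u) + 1) * (INR n + 1)).
Proof.
assert (HP := PI_RGT_0); assert (Hn := pos_INR n); assert (Hu := Rabs_pos (Im u)).
assert (Him : forall x : R, Im (RtoC x * u)%C = x * Im u) by (intros x; apply im_scal_l).
assert (H1 : 1 <= exp ((2 * PI * Rabs (Im u) + 1) * (INR n + 1))).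
{ rewrite <- exp_0 at 1; apply exp_mono, Rmult_le_pos; [|lra].
  assert (0 <= PI * Rabs (Im u)) by (apply Rmult_le_pos; lra); lra. }
assert (Hmon : forall x, 0 <= x -> x <= 2 * (INR n + 1) * PI ->
  cosh (x * Im u) <= exp ((2 * PI * Rabs (Im u) + 1) * (INR n + 1))).
{ intros x Hx Hx'; apply cosh_le_exp; rewrite Rabs_mult, (Rabs_pos_eq x Hx).
  apply Rle_trans with (2 * (INR n + 1) * PI * Rabs (Im u)).
  - now apply Rmult_le_compat_r.
  - lra. }
destruct m as [|m]; [destruct n as [|n]|]; cbn [theta_harmonic].
- rewrite Cmod_1; lra.
- rewrite Cmod_mult, Cmod_R, Rabs_pos_eq by lra; apply Rmult_le_compat_l; [lra|].
  eapply Rle_trans; [apply Cmod_Ccos_le_cosh|]; rewrite Him; apply Hmon.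
  + apply Rmult_le_pos; lra.
  + apply Rmult_le_compat_r; lra.
- eapply Rle_trans; [apply Cmod_Csin_le_cosh|]; rewrite Him.
  eapply Rle_trans; [apply Hmon|lra].
  + apply Rmult_le_pos; lra.
  + apply Rmult_le_compat_r; lra.
Qed.

Lemma Rabs_theta_weight_le (m n : nat) (b : R) : (m = 0 \/ m = 1)%nat -> 0 <= b ->
  Rabs (theta_weight m n) <= 2 * exp ((b + 1) * (INR n + 1)).
Proof.
intros Hm Hb; assert (Hn := pos_INR n).
assert (H : INR n + 1 <= exp ((b + 1) * (INR n + 1))).
{ eapply Rle_trans; [apply INR_plus_1_le_exp|]; apply exp_mono.
  assert (0 <= b * (INR n + 1)) by (apply Rmult_le_pos; lra); lra. }
destruct n as [|n]; unfold theta_weight.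
- rewrite Rabs_R1; change (INR 0) with 0 in *; lra.
- rewrite S_INR in *; assert (Hn' := pos_INR n).
  destruct Hm as [-> | ->]; simpl; rewrite Rabs_pos_eq; lra.
Qed.

Lemma nome_bounds (s : R) : 0 < s -> 0 < nome s < 1.
Proof.
intros Hs; unfold nome; split; [apply exp_pos|].
rewrite <- exp_0; apply exp_increasing.
assert (0 < PI ^ 2 * s) by (apply Rmult_lt_0_compat; [apply pow_lt, PI_RGT_0|exact Hs]); lra.
Qed.

Lemma nome_pow (s : R) (k : nat) : nome s ^ k = exp (- (INR k * (PI ^ 2 * s))).
Proof.
unfold nome; induction k as [|k IH]; [simpl; rewrite Rmult_0_l, Ropp_0; now rewrite exp_0|].
rewrite <- tech_pow_Rmult, IH, <- exp_plus, S_INR; f_equal; ring.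
Qed.

(** Completing the square in (b + 2) n - pi^2 s n^2 bounds the terms by a multiple of
    exp(- n). *)
Lemma theta_majorant (s b : R) (m : nat) : 0 < s ->
  exists M, ex_series M /\
  forall n, nome s ^ (n * n + m * n) * (2 * exp ((b + 1) * (INR n + 1))) <= M n.
Proof.
intros Hs.
set (x := PI ^ 2 * s).
assert (Hx : 0 < x) by (apply Rmult_lt_0_compat; [apply pow_lt, PI_RGT_0|exact Hs]).
exists (fun n => 2 * exp (b + 1 + (b + 2) ^ 2 / (4 * x)) * exp (-1) ^ n); split.
- apply (ex_series_scal_l (V := R_NormedModule)), ex_series_geom.
  rewrite Rabs_pos_eq by (left; apply exp_pos).
  rewrite <- exp_0; apply exp_increasing; lra.
- intros n; rewrite nome_pow, exp_pow; fold x.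
  replace (exp _ * (2 * exp _)) with
    (2 * (exp (- (INR (n * n + m * n) * x)) * exp ((b + 1) * (INR n + 1)))) by ring.
  rewrite Rmult_assoc, <- !exp_plus; apply Rmult_le_compat_l; [lra|]; apply exp_mono.
  rewrite plus_INR, !mult_INR.
  assert (Hn := pos_INR n); set (y := INR n) in *.
  clearbody x y; assert (H1 : 0 <= INR m * y * x) by
    (repeat apply Rmult_le_pos; auto using pos_INR; lra).
  assert (H2 : 0 <= (2 * x * y - (b + 2)) ^ 2 / (4 * x)).
  { apply Rdiv_le_0_compat; [apply pow2_ge_0|lra]. }
  replace ((2 * x * y - (b + 2)) ^ 2 / (4 * x))
    with (x * y * y - (b + 2) * y + (b + 2) ^ 2 / (4 * x)) in H2 by (field; lra).
  lra.
Qed.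

(** * The factors of the product expansion *)

Definition rate (m k : nat) : R := (INR k + (1 + INR m) / 2) * PI ^ 2.

(** The number a_k for which 1 + a_k is the factor number k of the product. *)
Definition factor (m : nat) (w : C) (k : nat) (s : R) : C :=
  (RtoC (/ sinh (rate m k * s) ^ 2) * w)%C.

Definition factor' (m : nat) (w : C) (k : nat) (s : R) : C :=
  (RtoC (- (2 * rate m k * cosh (rate m k * s) / sinh (rate m k * s) ^ 3)) * w)%C.

Lemma PI2_gt_1 : 1 < PI ^ 2.
Proof. assert (H := PI2_1); nra. Qed.

Lemma rate_pos (m k : nat) : 0 < rate m k.
Proof.
apply Rmult_lt_0_compat; [|apply pow_lt, PI_RGT_0].
generalize (pos_INR k) (pos_INR m); lra.
Qed.

Lemma rate_ge (m k : nat) : INR k <= rate m k.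
Proof.
unfold rate; assert (H := PI2_gt_1); assert (Hk := pos_INR k); assert (Hm := pos_INR m).
nra.
Qed.

Lemma rate_ge_0 (m k : nat) : rate m 0 <= rate m k.
Proof.
unfold rate; apply Rmult_le_compat_r; [apply pow2_ge_0|].
simpl (INR 0); generalize (pos_INR k); lra.
Qed.

(** For x bounded below, sinh x is at least a multiple of exp x; so both quantities are
    O(rate * exp(- 2 rate s)), and rate k >= k makes this geometric. *)
Lemma factor_majorant (m : nat) (t : R) : 0 < t ->
  exists M, ex_series M /\ forall k s, Rabs (s - t) < t / 2 ->
    / sinh (rate m k * s) ^ 2 <= M k /\
    2 * rate m k * cosh (rate m k * s) / sinh (rate m k * s) ^ 3 <= M k.
Proof.
intros Ht.
(* h is a lower bound of the s considered, and sinh x >= c0 exp x for x >= x0. *)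
set (h := t / 2); assert (Hh : 0 < h) by (unfold h; lra).
set (x0 := rate m 0 * h).
assert (Hx0 : 0 < x0) by (apply Rmult_lt_0_compat; [apply rate_pos|exact Hh]).
set (c0 := (1 - exp (- (2 * x0))) / 2).
assert (Hc0 : 0 < c0).
{ unfold c0; assert (exp (- (2 * x0)) < 1); [|lra].
  rewrite <- exp_0; apply exp_increasing; lra. }
exists (fun k => (/ c0 ^ 2 + 2 / h * / c0 ^ 3) * exp (- h) ^ k); split.
- apply (ex_series_scal_l (V := R_NormedModule)), ex_series_geom.
  rewrite Rabs_pos_eq by (left; apply exp_pos).
  rewrite <- exp_0; apply exp_increasing; lra.
- intros k s Hs; apply Rabs_def2 in Hs.
  assert (Hsh : h <= s) by (unfold h in *; lra).
  set (l := rate m k); assert (Hl : 0 < l) by apply rate_pos.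
  set (x := l * s).
  assert (Hlh : l * h <= x) by (apply Rmult_le_compat_l; lra).
  assert (Hxx : x0 <= x).
  { eapply Rle_trans; [|exact Hlh]; apply Rmult_le_compat_r; [lra|apply rate_ge_0]. }
  assert (He := exp_pos x).
  assert (Hsinh : c0 * exp x <= sinh x).
  { unfold sinh, c0.
    assert (exp (- x) <= exp (- (2 * x0)) * exp x); [|lra].
    rewrite <- exp_plus; apply exp_mono; lra. }
  assert (Hcosh : cosh x <= exp x).
  { apply cosh_le_exp; rewrite Rabs_pos_eq; lra. }
  assert (Hce : 0 < c0 * exp x) by (now apply Rmult_lt_0_compat).
  assert (Hg : exp (- (l * h)) <= exp (- h) ^ k).
  { rewrite exp_pow; apply exp_mono.
    assert (INR k * h <= l * h) by (apply Rmult_le_compat_r; [lra|apply rate_ge]); lra. }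
  assert (Hpk : 0 < exp (- h) ^ k) by (apply pow_lt, exp_pos).
  assert (H2x : exp (- x) * exp (- x) <= exp (- (l * h)) * exp (- (l * h))).
  { assert (exp (- x) <= exp (- (l * h))) by (apply exp_mono; lra).
    generalize (exp_pos (- x)); intros; apply Rmult_le_compat; lra. }
  assert (Hy : l * exp (- (l * h)) <= / h).
  { apply Rmult_le_reg_l with h; [lra|]; rewrite Rinv_r by lra.
    replace (h * (l * exp (- (l * h)))) with ((l * h) * exp (- (l * h))) by ring.
    rewrite exp_Ropp.
    assert (Hp := exp_pos (l * h)).
    apply Rle_div_l; [exact Hp|].
    assert (l * h <> 0) by (apply Rmult_integral_contrapositive; lra).
    generalize (exp_ineq1 (l * h)); intros Hi; specialize (Hi H); lra. }
  assert (Hone : exp (- (l * h)) <= 1).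
  { rewrite <- exp_0; apply exp_mono; assert (0 < l * h) by (apply Rmult_lt_0_compat; lra); lra. }
  assert (Hlh0 := exp_pos (- (l * h))).
  assert (Hi2 : 0 < / c0 ^ 2) by (apply Rinv_0_lt_compat, pow_lt; exact Hc0).
  assert (Hi3 : 0 < 2 / h * / c0 ^ 3).
  { apply Rmult_lt_0_compat; [apply Rdiv_lt_0_compat; lra|].
    apply Rinv_0_lt_compat, pow_lt; exact Hc0. }
  split.
  + apply Rle_trans with (/ c0 ^ 2 * exp (- h) ^ k); [|apply Rmult_le_compat_r; lra].
    apply Rle_trans with (/ (c0 * exp x) ^ 2).
    { apply Rinv_le_contravar; [apply pow_lt; exact Hce|apply pow_incr; lra]. }
    replace (/ (c0 * exp x) ^ 2) with (/ c0 ^ 2 * (exp (- x) * exp (- x))).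
    2: { rewrite exp_Ropp; field; lra. }
    apply Rmult_le_compat_l; [lra|].
    eapply Rle_trans; [exact H2x|]; eapply Rle_trans; [|exact Hg].
    rewrite <- (Rmult_1_r (exp (- (l * h)))) at 3; apply Rmult_le_compat_l; lra.
  + apply Rle_trans with ((2 / h * / c0 ^ 3) * exp (- h) ^ k);
      [|apply Rmult_le_compat_r; lra].
    apply Rle_trans with (2 * l * exp x / (c0 * exp x) ^ 3).
    { apply Rmult_le_compat.
      - apply Rmult_le_pos; [lra|]; unfold cosh; generalize (exp_pos (- x)); lra.
      - left; apply Rinv_0_lt_compat, pow_lt; lra.
      - apply Rmult_le_compat_l; lra.
      - apply Rinv_le_contravar; [apply pow_lt; exact Hce|apply pow_incr; lra]. }
    replace (2 * l * exp x / (c0 * exp x) ^ 3)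
      with (2 * / c0 ^ 3 * (l * (exp (- x) * exp (- x)))).
    2: { rewrite exp_Ropp; field; lra. }
    replace (2 / h * / c0 ^ 3 * exp (- h) ^ k)
      with (2 * / c0 ^ 3 * (/ h * exp (- h) ^ k)) by (unfold Rdiv; ring).
    assert (Hi3' : 0 < / c0 ^ 3) by (apply Rinv_0_lt_compat, pow_lt; exact Hc0).
    apply Rmult_le_compat_l; [lra|].
    apply Rle_trans with (l * (exp (- (l * h)) * exp (- (l * h)))).
    { apply Rmult_le_compat_l; lra. }
    rewrite <- Rmult_assoc; apply Rmult_le_compat; try lra.
    apply Rmult_le_pos; lra.
Qed.

Lemma is_Cderive_factor (m : nat) (w : C) (k : nat) (s : R) : 0 < s ->
  is_Cderive (factor m w k) s (factor' m w k s).
Proof.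
intros Hs; unfold factor, factor'.
set (l := rate m k).
assert (Hx : 0 < l * s) by (apply Rmult_lt_0_compat; [apply rate_pos|exact Hs]).
assert (Hsh := sinh_pos _ Hx); clearbody l.
assert (H : is_derive (fun s => / sinh (l * s) ^ 2) s
              (- (2 * l * cosh (l * s) / sinh (l * s) ^ 3))).
{ apply is_derive_Reals.
  assert (H1 : derivable_pt_lim (fun s => sinh (l * s)) s (cosh (l * s) * l)).
  { apply (derivable_pt_lim_comp (fun s => l * s) sinh); [|apply derivable_pt_lim_sinh].
    apply is_derive_Reals; auto_derive; [exact I|ring]. }
  apply is_derive_Reals in H1; apply is_derive_Reals.
  replace (- _) with (- (INR 2 * (cosh (l * s) * l) * sinh (l * s) ^ pred 2)
                       / (sinh (l * s) ^ 2) ^ 2) by (simpl; field; lra).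
  apply (is_derive_inv (fun s => sinh (l * s) ^ 2)).
  - now apply (is_derive_pow (fun s => sinh (l * s))).
  - apply pow_nonzero; lra. }
replace (RtoC (- (2 * l * cosh (l * s) / sinh (l * s) ^ 3)) * w)%C with
  (RtoC (- (2 * l * cosh (l * s) / sinh (l * s) ^ 3)) * w
   + RtoC (/ sinh (l * s) ^ 2) * 0)%C by ring.
apply (is_Cderive_mult (fun s => RtoC (/ sinh (l * s) ^ 2)) (fun _ => w)).
- now apply is_Cderive_RtoC.
- apply is_Cderive_const.
Qed.

Section Strip.
Variables (m : nat) (t : R) (u : C).
Hypothesis Ht : 0 < t.
Hypothesis Hu : PI * Rabs (Im u) < rate m 0 * t.

Let w : C := (Csin (PI * u) ^ 2)%C.

Lemma Ccos_2PI : (Ccos (2 * PI * u) = 1 - 2 * w)%C.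
Proof. rewrite <- (Cmult_assoc 2 PI u); apply Ccos_double. Qed.

Lemma denominator_double k :
  (RtoC (cosh (2 * (rate m k * t))) - Ccos (2 * PI * u)
   = 2 * (RtoC (sinh (rate m k * t) ^ 2) + w))%C.
Proof.
rewrite Ccos_2PI.
replace (cosh (2 * (rate m k * t))) with (2 * sinh (rate m k * t) ^ 2 + 1)
  by (rewrite sinh2_cosh; ring).
rewrite RtoC_plus, RtoC_mult; ring.
Qed.

(** 1 + a_k = (cosh(2x) - cos(2 pi u)) / (cosh(2x) - 1) with x = rate k * t.  As
    |cos(2 pi u)| <= cosh(2 pi Im u), which is at least 1, the lower bound obtained by
    the triangle inequality increases with x; it is positive at k = 0 in the strip. *)
Lemma factor_plus_1_ge : exists mu, 0 < mu /\
  forall k, mu <= Cmod (1 + factor m w k t).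
Proof.
assert (HP := PI_RGT_0).
set (Y := cosh (2 * PI * Im u)); set (C0 := cosh (2 * (rate m 0 * t))).
assert (HY : 1 <= Y) by apply cosh_ge_1.
assert (HC0 : Y < C0).
{ unfold Y, C0; rewrite <- cosh_Rabs; apply cosh_lt; split; [apply Rabs_pos|].
  rewrite Rabs_mult, (Rabs_pos_eq (2 * PI)) by lra; lra. }
exists ((C0 - Y) / (C0 - 1)); split; [apply Rdiv_lt_0_compat; lra|intros k].
set (x := rate m k * t).
assert (Hx : 0 < x) by (apply Rmult_lt_0_compat; [apply rate_pos|exact Ht]).
assert (Hsh : 0 < sinh x ^ 2) by (apply pow_lt, sinh_pos, Hx).
set (K := cosh (2 * x)).
assert (HK : C0 <= K).
{ assert (Hr : rate m 0 * t <= x) by (apply Rmult_le_compat_r; [lra|apply rate_ge_0]).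
  assert (H0 : 0 < rate m 0 * t) by (apply Rmult_lt_0_compat; [apply rate_pos|exact Ht]).
  unfold C0, K; destruct Hr as [Hr| ->]; [left; apply cosh_lt; lra|right; reflexivity]. }
assert (HK2 : 2 * sinh x ^ 2 = K - 1) by apply sinh2_cosh.
replace (1 + factor m w k t)%C with
  ((RtoC K - Ccos (2 * PI * u)) / RtoC (K - 1))%C.
2: { unfold K, x; rewrite denominator_double; fold x; fold K.
     unfold factor; fold x; rewrite <- HK2, RtoC_inv, RtoC_mult by lra.
     field; repeat split; intros E; apply RtoC_inj in E; lra. }
rewrite Cmod_div by (intros E; apply RtoC_inj in E; lra).
rewrite (Cmod_R (K - 1)), Rabs_pos_eq by lra.
assert (Hlow : K - Y <= Cmod (RtoC K - Ccos (2 * PI * u))%C).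
{ assert (HcY : Cmod (Ccos (2 * PI * u)) <= Y).
  { eapply Rle_trans; [apply Cmod_Ccos_le_cosh|]; right; unfold Y; f_equal.
    rewrite <- RtoC_mult; apply im_scal_l. }
  assert (Htri := Cmod_triangle (RtoC K - Ccos (2 * PI * u))%C (Ccos (2 * PI * u))).
  replace (RtoC K - Ccos (2 * PI * u) + Ccos (2 * PI * u))%C with (RtoC K) in Htri by ring.
  rewrite Cmod_R, Rabs_pos_eq in Htri by lra; lra. }
apply Rle_trans with ((K - Y) / (K - 1)).
- apply Rle_div_l; [lra|].
  replace ((K - Y) / (K - 1) * (C0 - 1)) with ((K - Y) * (C0 - 1) / (K - 1)) by (field; lra).
  apply Rle_div_r; [lra|]; nra.
- apply Rmult_le_compat_r; [left; apply Rinv_0_lt_compat; lra|exact Hlow].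
Qed.

Lemma factor_log_derivative k :
  (factor' m w k t / (1 + factor m w k t)
   = - (RtoC (2 * rate m k * coth (rate m k * t)) * w
        / (RtoC (sinh (rate m k * t) ^ 2) + w)))%C.
Proof.
destruct factor_plus_1_ge as [mu [Hmu Hk]].
assert (Hnz : (1 + factor m w k t)%C <> 0%C) by (apply Cmod_gt_0; specialize (Hk k); lra).
unfold factor, factor' in *.
set (x := rate m k * t) in *.
assert (Hx : 0 < x) by (apply Rmult_lt_0_compat; [apply rate_pos|exact Ht]).
assert (Hsh := sinh_pos x Hx).
assert (Hs0 : RtoC (sinh x) <> 0%C) by (intros E; apply RtoC_inj in E; lra).
assert (Hp : RtoC (/ sinh x ^ 2) = (/ (RtoC (sinh x) * RtoC (sinh x)))%C).
{ rewrite RtoC_inv by (apply pow_nonzero; lra); rewrite RtoC_pow.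
  f_equal; ring. }
assert (Hd : (RtoC (sinh x) * RtoC (sinh x) + w)%C <> 0%C).
{ intros E; apply Hnz; rewrite Hp.
  replace (1 + / (RtoC (sinh x) * RtoC (sinh x)) * w)%C with
    (/ (RtoC (sinh x) * RtoC (sinh x)) * (RtoC (sinh x) * RtoC (sinh x) + w))%C
    by (field; exact Hs0).
  rewrite E; ring. }
replace (RtoC (sinh x ^ 2)) with (RtoC (sinh x) * RtoC (sinh x))%C
  by (rewrite <- RtoC_mult; f_equal; ring).
rewrite Hp in *.
replace (RtoC (- (2 * rate m k * cosh x / sinh x ^ 3))) with
  (- (RtoC (2 * rate m k * coth x) / (RtoC (sinh x) * RtoC (sinh x))))%C.
2: { rewrite <- RtoC_mult, <- RtoC_div, <- RtoC_opp by nra; f_equal; unfold coth; field; lra. }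
field; repeat split; auto.
Qed.

Lemma log_derivative_majorant : exists M, ex_series M /\
  forall k, Cmod (factor' m w k t / (1 + factor m w k t))%C <= M k /\
            Cmod (factor m w k t / (1 + factor m w k t))%C <= M k.
Proof.
destruct factor_plus_1_ge as [mu [Hmu Hk]].
destruct (factor_majorant m t Ht) as [M [HM HMk]].
exists (fun k => Cmod w / mu * M k); split; [now apply (ex_series_scal_l (V := R_NormedModule))|].
intros k.
destruct (HMk k t) as [H1 H2]; [rewrite Rminus_diag, Rabs_R0; lra|].
set (x := rate m k * t) in *.
assert (Hx : 0 < x) by (apply Rmult_lt_0_compat; [apply rate_pos|exact Ht]).
assert (Hsh := sinh_pos x Hx).
assert (Hr := rate_pos m k).
assert (Hc := cosh_ge_1 x).
specialize (Hk k).
assert (Hnz : (1 + factor m w k t)%C <> 0%C) by (apply Cmod_gt_0; lra).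
assert (Hq : forall c, Rabs c <= M k ->
  Cmod (RtoC c * w / (1 + factor m w k t))%C <= Cmod w / mu * M k).
{ intros c Hc'; rewrite Cmod_div, Cmod_mult, Cmod_R by exact Hnz.
  replace (Cmod w / mu * M k) with (M k * Cmod w * / mu) by (unfold Rdiv; ring).
  apply Rmult_le_compat.
  - apply Rmult_le_pos; [apply Rabs_pos|apply Cmod_ge_0].
  - left; apply Rinv_0_lt_compat; lra.
  - apply Rmult_le_compat_r; [apply Cmod_ge_0|exact Hc'].
  - apply Rinv_le_contravar; lra. }
split; apply Hq; fold x.
- rewrite Rabs_Ropp, Rabs_pos_eq; [exact H2|].
  apply Rdiv_le_0_compat; [|apply pow_lt; lra].
  apply Rmult_le_pos; lra.
- rewrite Rabs_pos_eq; [exact H1|].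
  left; apply Rinv_0_lt_compat, pow_lt; lra.
Qed.

Lemma is_Cderive_theta_product :
  is_Cderive (fun s => Cinfprod (fun k => factor m w k s)) t
    (Cinfprod (fun k => factor m w k t)
     * CSeries (fun k => factor' m w k t / (1 + factor m w k t)))%C
  /\ Cinfprod (fun k => factor m w k t) <> 0%C.
Proof.
destruct factor_plus_1_ge as [mu [Hmu Hk]].
destruct (factor_majorant m t Ht) as [M [HM HMk]].
destruct log_derivative_majorant as [M' [HM' HMk']].
assert (Hnz : forall k, (1 + factor m w k t)%C <> 0%C).
{ intros k; apply Cmod_gt_0; specialize (Hk k); lra. }
set (M1 := fun k => Cmod w * M k).
assert (HM1 : ex_series M1) by now apply (ex_series_scal_l (V := R_NormedModule)).
assert (Hb : forall k s, Rabs (s - t) < t / 2 ->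
  0 < s /\ Cmod (factor m w k s) <= M1 k /\ Cmod (factor' m w k s) <= M1 k).
{ intros k s Hs; destruct (HMk k s Hs) as [H1 H2].
  apply Rabs_def2 in Hs; assert (Hs0 : 0 < s) by lra.
  unfold factor, factor', M1; rewrite !Cmod_mult, !Cmod_R, !(Rmult_comm _ (Cmod w)).
  set (x := rate m k * s) in *.
  assert (Hx : 0 < x) by (apply Rmult_lt_0_compat; [apply rate_pos|lra]).
  assert (Hsh := sinh_pos x Hx); assert (Hc := cosh_ge_1 x); assert (Hr := rate_pos m k).
  split; [lra|split; (apply Rmult_le_compat_l; [apply Cmod_ge_0|])].
  - rewrite Rabs_pos_eq; [exact H1|left; apply Rinv_0_lt_compat, pow_lt; lra].
  - rewrite Rabs_Ropp, Rabs_pos_eq; [exact H2|].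
    apply Rdiv_le_0_compat; [apply Rmult_le_pos; lra|apply pow_lt; lra]. }
assert (Ht2 : Rabs (t - t) < t / 2) by (rewrite Rminus_diag, Rabs_R0; lra).
split.
- apply (is_Cderive_Cinfprod (factor m w) (factor' m w) M1 M' t (t / 2)); auto; try lra.
  + intros k s Hs; apply is_Cderive_factor, (Hb k s Hs).
  + intros k s Hs; apply (Hb k s Hs).
  + intros k s Hs; apply (Hb k s Hs).
  + intros k; apply HMk'.
- apply (Cinfprod_neq_0 _ M1 M'); auto.
  + intros k; apply (Hb k t Ht2).
  + intros k; apply HMk'.
Qed.

(** If F is a product kappa * tau * P and G a multiple of tau, the logarithmic
    derivatives of tau cancel and - P' / P is left. *)
Lemma two_expansions_product (F G : R -> C) (kappa : C) (kappa0 : R) (tau : R -> R) :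
  (forall s, 0 < s -> F s = (kappa * tau s * Cinfprod (fun k => factor m w k s))%C) ->
  (forall s, 0 < s -> G s = RtoC (kappa0 * tau s)) ->
  ex_derive tau t -> kappa <> 0%C -> kappa0 <> 0 -> tau t <> 0 ->
  two_expansions (- (CDerive F t / F t) + CDerive G t / G t)%C
    (fun k => RtoC (2 * rate m k * coth (rate m k * t)) * w
              / (RtoC (sinh (rate m k * t) ^ 2) + w))%C
    (fun k => RtoC (2 * rate m k * coth (rate m k * t)) * w
              / (RtoC (cosh (2 * (rate m k * t))) - Ccos (2 * PI * u)))%C.
Proof.
intros HF HG [tau' Htau] Hk Hk0 Ht0.
destruct is_Cderive_theta_product as [HP HP0].
destruct log_derivative_majorant as [M [HM HMk]].
set (P := fun s => Cinfprod (fun k => factor m w k s)) in *.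
set (a := fun k => (RtoC (2 * rate m k * coth (rate m k * t)) * w
              / (RtoC (sinh (rate m k * t) ^ 2) + w))%C).
set (b := fun k => (RtoC (2 * rate m k * coth (rate m k * t)) * w
              / (RtoC (cosh (2 * (rate m k * t))) - Ccos (2 * PI * u)))%C).
assert (Hab : forall k, (factor' m w k t / (1 + factor m w k t) = - (1) * a k)%C).
{ intros k; unfold a; rewrite factor_log_derivative; ring. }
assert (HaM : forall k, Cmod (a k) <= M k).
{ intros k; rewrite <- Cmod_opp; replace (- a k)%C with (- (1) * a k)%C by ring.
  rewrite <- Hab; apply HMk. }
assert (Hhalf : forall k, b k = (RtoC (/ 2) * a k)%C).
{ intros k; unfold a, b; rewrite denominator_double, RtoC_inv by lra.
  unfold Cdiv.
  destruct factor_plus_1_ge as [mu [Hmu Hk']].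
  set (D := (RtoC (sinh (rate m k * t) ^ 2) + w)%C).
  assert (HD : D <> 0%C).
  { intros E; specialize (Hk' k).
    replace (1 + factor m w k t)%C with (RtoC (/ sinh (rate m k * t) ^ 2) * D)%C in Hk'.
    - rewrite E, Cmult_0_r, Cmod_0 in Hk'; lra.
    - assert (Hs : 0 < sinh (rate m k * t)).
      { apply sinh_pos, Rmult_lt_0_compat; [apply rate_pos|exact Ht]. }
      unfold D, factor; rewrite Cmult_plus_distr_l, <- RtoC_mult, Rinv_l; [reflexivity|].
      apply pow_nonzero; lra. }
  field; Cnz. }
assert (HCa : CSeries (fun k => factor' m w k t / (1 + factor m w k t))%C
              = (- CSeries a)%C).
{ rewrite (CSeries_ext _ _ Hab), (CSeries_scal _ _ M) by assumption; ring. }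
assert (Hloc : locally t (fun s => 0 < s)).
{ exists (mkposreal t Ht); intros s Hs; change (Rabs (s - t) < t) in Hs.
  apply Rabs_def2 in Hs; lra. }
assert (DF : CDerive F t = (kappa * tau' * P t + kappa * tau t * (P t * - CSeries a))%C).
{ apply is_Cderive_unique.
  apply is_Cderive_ext_loc with (fun s => kappa * tau s * P s)%C.
  { revert Hloc; apply filter_imp; intros s Hs; symmetry; now apply HF. }
  rewrite <- HCa; apply (is_Cderive_mult (fun s => kappa * tau s)%C P); [|exact HP].
  replace (kappa * tau')%C with (0 * tau t + kappa * tau')%C by ring.
  apply (is_Cderive_mult (fun _ => kappa) (fun s => RtoC (tau s)));
    [apply is_Cderive_const|now apply is_Cderive_RtoC]. }
assert (DG : CDerive G t = RtoC (kappa0 * tau')).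
{ apply is_Cderive_unique.
  apply is_Cderive_ext_loc with (fun s => RtoC (kappa0 * tau s)).
  { revert Hloc; apply filter_imp; intros s Hs; symmetry; now apply HG. }
  apply is_Cderive_RtoC; now apply (is_derive_scal tau). }
repeat split.
- now apply ex_Cseries_dominated with M.
- apply ex_Cseries_dominated with (fun k => / 2 * M k).
  + now apply (ex_series_scal_l (V := R_NormedModule)).
  + intros k; fold (b k); rewrite Hhalf, Cmod_mult, Cmod_R, Rabs_pos_eq by lra.
    apply Rmult_le_compat_l; [lra|apply HaM].
- fold a; rewrite DF, DG, HF, HG, !RtoC_mult by exact Ht; fold (P t).
  field; repeat split; auto; intros E; apply RtoC_inj in E; auto.
- fold a b; rewrite (CSeries_ext b _ Hhalf), (CSeries_scal _ _ M), RtoC_inv by (auto; lra).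
  field; apply C2_neq_0.
Qed.

End Strip.

(** * Theta sums as infinite products *)

(** The theta constants: theta4(0,s) for m = 0, and the u-derivative of theta1 at 0
    divided by 2 pi q^(1/4) for m = 1. *)
Definition theta_null (m : nat) (s : R) : R :=
  Series (fun n => (-1) ^ n * nome s ^ (n * n + m * n) * theta_weight m n).

(** With g = exp(- 2x), x = rate k * s, one has 4 g / (1 - g)^2 = 1 / sinh^2 x. *)
Lemma factor_eq_nome (m : nat) (w : C) (k : nat) (s : R) : 0 < s ->
  factor m w k s
  = (2 * factor_nome (nome s) m k * (1 - (1 - 2 * w)) / (1 - factor_nome (nome s) m k) ^ 2)%C.
Proof.
intros Hs; unfold factor.
set (x := rate m k * s).
assert (Hx : 0 < x) by (apply Rmult_lt_0_compat; [apply rate_pos|exact Hs]).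
assert (Hg : factor_nome (nome s) m k = exp (- (2 * x))).
{ unfold factor_nome; rewrite nome_pow; f_equal; unfold x, rate.
  rewrite !plus_INR, mult_INR; simpl; field. }
set (g := factor_nome (nome s) m k) in *.
assert (Hg1 : g < 1) by (rewrite Hg, <- exp_0; apply exp_increasing; lra).
assert (Hg0 : 0 < g) by (rewrite Hg; apply exp_pos).
replace (/ sinh x ^ 2) with (4 * g / (1 - g) ^ 2).
- rewrite RtoC_div, RtoC_mult, RtoC_pow, RtoC_minus by (apply pow_nonzero; lra).
  field; intros E; rewrite <- RtoC_minus in E; apply RtoC_inj in E; lra.
- assert (He := exp_pos x).
  assert (Hg2 : g = / (exp x * exp x)).
  { rewrite Hg, exp_Ropp, <- exp_plus; do 2 f_equal; ring. }
  assert (Hsx := sinh_pos x Hx); unfold sinh in *; rewrite exp_Ropp in *.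
  rewrite Hg2.
  assert (H1 : exp x * exp x <> 1).
  { rewrite <- exp_plus, <- exp_0; intros E; apply exp_inv in E; lra. }
  assert (H2 : exp x * exp x - 1 <> 0) by lra.
  field; repeat split; nra.
Qed.

Lemma ex_series_factor (m : nat) (w : C) (s : R) : 0 < s ->
  exists M, ex_series M /\ forall k, Cmod (factor m w k s) <= M k.
Proof.
intros Hs; destruct (factor_majorant m s Hs) as [M [HM HMk]].
exists (fun k => Cmod w * M k); split; [now apply (ex_series_scal_l (V := R_NormedModule))|].
intros k; unfold factor; rewrite Cmod_mult, Cmod_R, Rmult_comm.
apply Rmult_le_compat_l; [apply Cmod_ge_0|].
assert (Hsh : 0 < sinh (rate m k * s)).
{ apply sinh_pos, Rmult_lt_0_compat; [apply rate_pos|exact Hs]. }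
rewrite Rabs_pos_eq; [|left; apply Rinv_0_lt_compat, pow_lt; lra].
apply (HMk k s); rewrite Rminus_diag, Rabs_R0; lra.
Qed.

Lemma theta_sum_weight (m : nat) (s : R) :
  theta_sum (nome s) m (fun n => RtoC (theta_weight m n)) = RtoC (theta_null m s).
Proof.
unfold theta_sum, theta_null; rewrite <- CSeries_RtoC; apply CSeries_ext; intros n.
now rewrite (RtoC_mult (_ * _)).
Qed.

Lemma theta_product (m : nat) (c w : C) (Z : nat -> C) (b s : R) :
  (m = 0 \/ m = 1)%nat -> 0 < s -> 0 <= b ->
  trig_sequence m c Z -> (c = 1 - 2 * w)%C ->
  (forall n, Cmod (Z n) <= 2 * exp ((b + 1) * (INR n + 1))) ->
  theta_sum (nome s) m Z
  = (Z 0%nat * Cinfprod (fun k => factor m w k s) * theta_null m s)%C.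
Proof.
intros Hm Hs Hb HZ Hc HZb.
destruct (theta_majorant s b m Hs) as [M [HM HMn]].
destruct (ex_series_factor m w s Hs) as [Ma [HMa HMak]].
assert (Hq := nome_bounds s Hs).
rewrite <- theta_sum_weight.
apply (theta_sum_quotient (nome s) m Hq Hm c _ _ M _ Ma); auto.
- now apply trig_sequence_weight.
- intros n; eapply Rle_trans; [|apply HMn].
  apply Rmult_le_compat_l; [left; apply pow_lt; lra|apply HZb].
- intros n; eapply Rle_trans; [|apply HMn].
  apply Rmult_le_compat_l; [left; apply pow_lt; lra|].
  rewrite Cmod_R; now apply Rabs_theta_weight_le.
- intros k; rewrite Hc; now apply factor_eq_nome.
Qed.

Lemma theta_sum_harmonic (m : nat) (u : C) (s : R) :
  (m = 0 \/ m = 1)%nat -> 0 < s ->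
  theta_sum (nome s) m (theta_harmonic m u)
  = (theta_harmonic m u 0 * Cinfprod (fun k => factor m (Csin (PI * u) ^ 2) k s)
     * theta_null m s)%C.
Proof.
intros Hm Hs.
apply (theta_product m (Ccos (2 * PI * u)) _ _ (2 * PI * Rabs (Im u))); auto.
- assert (HP := PI_RGT_0); assert (Hu := Rabs_pos (Im u)); apply Rmult_le_pos; lra.
- now apply trig_sequence_harmonic.
- apply Ccos_2PI.
- intros n; apply Cmod_theta_harmonic_le.
Qed.

(** At u = 1/2 the signs (-1)^n disappear and the theta sum is at least 1; it is also
    a multiple of the theta constant. *)
Lemma theta_null_0_neq_0 (s : R) : 0 < s -> theta_null 0 s <> 0.
Proof.
intros Hs H0.
assert (H : theta_sum (nome s) 0 (fun n => RtoC ((-1) ^ n * theta_weight 0 n)) = 0%C).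
{ rewrite (theta_product 0 (-1) 1 _ 0 s); auto; try lra.
  - rewrite H0; ring.
  - apply trig_sequence_alternating_weight.
  - rewrite <- RtoC_mult, <- RtoC_minus; f_equal; ring.
  - intros n; rewrite Cmod_R, Rabs_mult, pow_1_abs, Rmult_1_l.
    apply Rabs_theta_weight_le; auto; lra. }
assert (Hq := nome_bounds s Hs).
set (p := fun n => nome s ^ (n * n + 0 * n) * theta_weight 0 n).
assert (Hp : forall n, 0 <= p n).
{ intros n; apply Rmult_le_pos; [left; apply pow_lt; lra|].
  destruct n; simpl; lra. }
assert (E : theta_sum (nome s) 0 (fun n => RtoC ((-1) ^ n * theta_weight 0 n))
            = RtoC (Series p)).
{ unfold theta_sum; rewrite <- CSeries_RtoC; apply CSeries_ext; intros n.
  rewrite <- RtoC_mult; f_equal; unfold p.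
  transitivity (((-1) ^ n * (-1) ^ n) * (nome s ^ (n * n + 0 * n) * theta_weight 0 n)); [ring|].
  rewrite <- Rpow_mult_distr; replace (-1 * -1) with 1 by ring; rewrite pow1; ring. }
rewrite E in H; apply RtoC_inj in H.
destruct (theta_majorant s 0 0 Hs) as [M [HM HMn]].
assert (Hex : ex_series p).
{ apply ex_series_dominated with M; auto; intros n.
  unfold p; rewrite Rabs_mult, Rabs_pos_eq by (left; apply pow_lt; lra).
  eapply Rle_trans; [|apply HMn].
  apply Rmult_le_compat_l; [left; apply pow_lt; lra|].
  apply Rabs_theta_weight_le; auto; lra. }
assert (H1 := sum_n_le_Series p 0 Hex Hp).
rewrite sum_O, H in H1; unfold p in H1; simpl in H1; lra.
Qed.

(** The factor n^2 + m n of the derivative is absorbed by half of the Gaussian decay,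
    since y exp(- y) <= 1. *)
Lemma ex_derive_theta_null (m : nat) (t : R) : (m = 0 \/ m = 1)%nat -> 0 < t ->
  ex_derive (theta_null m) t.
Proof.
intros Hm Ht.
set (x := fun n => INR (n * n + m * n) * PI ^ 2).
assert (Hx : forall n, 0 <= x n).
{ intros n; apply Rmult_le_pos; [apply pos_INR|apply pow2_ge_0]. }
set (f := fun n s => (-1) ^ n * nome s ^ (n * n + m * n) * theta_weight m n).
set (f' := fun n s => (-1) ^ n * (- x n * nome s ^ (n * n + m * n)) * theta_weight m n).
(* For s > t / 2, exp (- x s) is at most the square of exp (- x t / 4): one factor
   absorbs x, the other one is the majorant at t / 4. *)
destruct (theta_majorant (t / 4) 0 m) as [M [HM HMn]]; [lra|].
exists (Series (fun n => f' n t)).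
apply (is_derive_Series f f' (fun n => 4 / t * M n) t (t / 2)); [lra| | | |].
- now apply (ex_series_scal_l (V := R_NormedModule)).
- intros n s _; unfold f, f', nome.
  apply is_derive_ext with
    (fun s => (-1) ^ n * exp (- (x n * s)) * theta_weight m n).
  { intros r; change (exp (- (PI ^ 2 * r))) with (nome r).
    rewrite nome_pow; unfold x; do 4 f_equal; ring. }
  change (exp (- (PI ^ 2 * s))) with (nome s); rewrite nome_pow.
  replace (INR (n * n + m * n) * (PI ^ 2 * s)) with (x n * s) by (unfold x; ring).
  auto_derive; [exact I|ring].
- intros n s Hs; apply Rabs_def2 in Hs; unfold f'.
  rewrite !Rabs_mult, pow_1_abs, Rmult_1_l, Rabs_Ropp, (Rabs_pos_eq (x n)) by apply Hx.
  rewrite Rabs_pos_eq by (rewrite nome_pow; left; apply exp_pos).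
  apply Rle_trans with (4 / t * (nome (t / 4) ^ (n * n + m * n)
                                 * (2 * exp ((0 + 1) * (INR n + 1))))).
  2: { apply Rmult_le_compat_l; [|apply HMn]; apply Rdiv_le_0_compat; lra. }
  rewrite <- Rmult_assoc; apply Rmult_le_compat.
  + apply Rmult_le_pos; [apply Hx|rewrite nome_pow; left; apply exp_pos].
  + apply Rabs_pos.
  + rewrite !nome_pow.
    replace (INR (n * n + m * n) * (PI ^ 2 * s)) with (x n * s) by (unfold x; ring).
    replace (INR (n * n + m * n) * (PI ^ 2 * (t / 4))) with (x n * (t / 4)) by (unfold x; ring).
    specialize (Hx n).
    set (y := x n * (t / 4)).
    assert (Hy : 0 <= y) by (apply Rmult_le_pos; lra).
    assert (H1 : exp (- (x n * s)) <= exp (- y) * exp (- y)).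
    { rewrite <- exp_plus; apply exp_mono; unfold y.
      assert (x n * (t / 2) <= x n * s) by (apply Rmult_le_compat_l; lra); lra. }
    assert (H2 : y * exp (- y) <= 1).
    { rewrite exp_Ropp; apply Rle_div_l; [apply exp_pos|].
      destruct Hy as [Hy| <-]; [|generalize (exp_pos 0); lra].
      generalize (exp_ineq1 y); lra. }
    replace (x n) with (4 / t * y) at 1 by (unfold y; field; lra).
    rewrite Rmult_assoc; apply Rmult_le_compat_l; [apply Rdiv_le_0_compat; lra|].
    apply Rle_trans with (y * (exp (- y) * exp (- y))).
    * now apply Rmult_le_compat_l.
    * apply Rle_trans with (1 * exp (- y)); [|lra].
      rewrite <- Rmult_assoc; apply Rmult_le_compat_r; [left; apply exp_pos|exact H2].
  + apply Rabs_theta_weight_le; auto; lra.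
- intros s Hs; apply Rabs_def2 in Hs.
  assert (Hs0 : 0 < s) by lra.
  destruct (theta_majorant s 0 m Hs0) as [M' [HM' HMn']].
  apply ex_series_dominated with M'; auto; intros n; unfold f.
  rewrite !Rabs_mult, pow_1_abs, Rmult_1_l.
  rewrite Rabs_pos_eq by (rewrite nome_pow; left; apply exp_pos).
  eapply Rle_trans; [|apply HMn'].
  apply Rmult_le_compat_l; [rewrite nome_pow; left; apply exp_pos|].
  apply Rabs_theta_weight_le; auto; lra.
Qed.

Lemma theta_harmonic_majorant (m : nat) (u : C) (s : R) : 0 < s ->
  exists M, ex_series M /\
  forall n, Cmod (RtoC ((-1) ^ n * nome s ^ (n * n + m * n)) * theta_harmonic m u n)%C <= M n.
Proof.
intros Hs.
destruct (theta_majorant s (2 * PI * Rabs (Im u)) m Hs) as [M [HM HMn]].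
exists M; split; [exact HM|intros n].
rewrite Cmod_mult, Cmod_R, Rabs_mult, pow_1_abs, Rmult_1_l.
assert (Hq := nome_bounds s Hs).
rewrite Rabs_pos_eq by (left; apply pow_lt; lra).
eapply Rle_trans; [|apply HMn].
apply Rmult_le_compat_l; [left; apply pow_lt; lra|apply Cmod_theta_harmonic_le].
Qed.

(** * The four theta functions *)

Lemma theta4_eq_sum (u : C) (s : R) : 0 < s ->
  theta4 u s = theta_sum (nome s) 0 (theta_harmonic 0 u).
Proof.
intros Hs; destruct (theta_harmonic_majorant 0 u s Hs) as [M [HM HMn]].
unfold theta_sum, theta4; rewrite (CSeries_incr_1 _ M HM HMn).
change (theta_harmonic 0 u 0) with (RtoC 1).
replace ((-1) ^ 0 * nome s ^ (0 * 0 + 0 * 0)) with 1 by (simpl; ring).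
rewrite Cmult_1_r; f_equal.
rewrite <- (CSeries_scal 2 _ (fun n => M (S n))).
- apply CSeries_ext; intros n; cbn [theta_harmonic].
  replace (S n ^ 2)%nat with (S n * S n + 0 * S n)%nat by (simpl; lia); ring.
- now apply (ex_series_incr_1 M).
- intros n; specialize (HMn (S n)); cbn [theta_harmonic] in HMn.
  replace (S n ^ 2)%nat with (S n * S n + 0 * S n)%nat by (simpl; lia).
  eapply Rle_trans; [|exact HMn]; rewrite !Cmod_mult, (Cmod_R 2), Rabs_pos_eq by lra.
  set (A := Cmod (RtoC _)); set (B := Cmod (Ccos _)).
  assert (0 <= A * B) by (apply Rmult_le_pos; apply Cmod_ge_0); lra.
Qed.

Lemma theta4_0 (s : R) : 0 < s -> theta4 0 s = RtoC (theta_null 0 s).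
Proof.
intros Hs; rewrite (theta4_eq_sum _ _ Hs), <- theta_sum_weight.
unfold theta_sum; apply CSeries_ext; intros n; f_equal.
destruct n as [|n]; cbn [theta_harmonic theta_weight]; [reflexivity|].
rewrite Cmult_0_r, Ccos_0, Cmult_1_r; f_equal; simpl; ring.
Qed.

Lemma theta4_product (u : C) (s : R) : 0 < s ->
  theta4 u s = (1 * theta_null 0 s * Cinfprod (fun k => factor 0 (Csin (PI * u) ^ 2) k s))%C.
Proof.
intros Hs; rewrite theta4_eq_sum, theta_sum_harmonic by auto; cbn [theta_harmonic]; ring.
Qed.

(** Twice q^(1/4), the factor between q^((n + 1/2)^2) and q^(n^2 + n). *)
Definition theta1_scale (s : R) : R := 2 * exp (- (PI ^ 2 * s) / 4).

Lemma Rpower_nome (s : R) (n : nat) :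
  2 * Rpower (nome s) ((INR n + 1 / 2) ^ 2) = theta1_scale s * nome s ^ (n * n + 1 * n).
Proof.
rewrite nome_pow; unfold theta1_scale, Rpower, nome; rewrite ln_exp, Rmult_assoc, <- exp_plus.
do 2 f_equal; rewrite plus_INR, !mult_INR; simpl; field.
Qed.

Lemma theta1_eq_sum (u : C) (s : R) : 0 < s ->
  theta1 u s = (theta1_scale s * theta_sum (nome s) 1 (theta_harmonic 1 u))%C.
Proof.
intros Hs; destruct (theta_harmonic_majorant 1 u s Hs) as [M [HM HMn]].
unfold theta_sum, theta1.
rewrite <- (CSeries_scal (theta1_scale s) _ M HM HMn).
set (X := theta1_scale s).
assert (E : forall n, (RtoC ((-1) ^ n * Rpower (nome s) ((INR n + 1 / 2) ^ 2))
   * Csin (RtoC ((2 * INR n + 1) * PI) * u)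
  = RtoC (X / 2) * (RtoC ((-1) ^ n * nome s ^ (n * n + 1 * n)) * theta_harmonic 1 u n))%C).
{ intros n; cbn [theta_harmonic]; rewrite Cmult_assoc, <- RtoC_mult; do 2 f_equal.
  assert (H := Rpower_nome s n); fold X in H.
  replace (Rpower (nome s) ((INR n + 1 / 2) ^ 2))
    with (2 * Rpower (nome s) ((INR n + 1 / 2) ^ 2) / 2) by field.
  rewrite H; field. }
rewrite (CSeries_ext _ _ E), !(CSeries_scal _ _ M HM HMn).
rewrite RtoC_div by lra; field; apply C2_neq_0.
Qed.

Lemma theta1_product (u : C) (s : R) : 0 < s ->
  theta1 u s = (Csin (PI * u) * (theta1_scale s * theta_null 1 s)%R
                * Cinfprod (fun k => factor 1 (Csin (PI * u) ^ 2) k s))%C.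
Proof.
intros Hs; rewrite theta1_eq_sum, theta_sum_harmonic by auto; cbn [theta_harmonic].
change (INR 0) with 0; replace ((2 * 0 + 1) * PI) with PI by ring.
rewrite RtoC_mult; ring.
Qed.

Lemma theta1_real (x s : R) : theta1 x s =
  RtoC (Series (fun n => (-1) ^ n * (2 * Rpower (nome s) ((INR n + 1 / 2) ^ 2))
                         * sin ((2 * INR n + 1) * PI * x))).
Proof.
unfold theta1.
assert (E : forall n, (RtoC ((-1) ^ n * Rpower (nome s) ((INR n + 1 / 2) ^ 2))
   * Csin (RtoC ((2 * INR n + 1) * PI) * x)
  = RtoC (/ 2 * ((-1) ^ n * (2 * Rpower (nome s) ((INR n + 1 / 2) ^ 2))
                         * sin ((2 * INR n + 1) * PI * x))))%C).
{ intros n; rewrite <- (RtoC_mult _ x), Csin_RtoC, <- RtoC_mult; f_equal; field. }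
rewrite (CSeries_ext _ _ E), CSeries_RtoC, Series_scal_l, <- RtoC_mult; f_equal; field.
Qed.

(** [C_derive] takes the limit of the difference quotients along the horizontal line,
    on which theta1 is a real series that can be differentiated term by term. *)
Lemma du_theta1_0 (s : R) : 0 < s ->
  du theta1 0 s = RtoC (PI * (theta1_scale s * theta_null 1 s)).
Proof.
intros Hs.
set (E := fun n => theta1_scale s * nome s ^ (n * n + 1 * n)).
assert (HE : forall n, 2 * Rpower (nome s) ((INR n + 1 / 2) ^ 2) = E n)
  by (intros n; apply Rpower_nome).
assert (HE0 : forall n, 0 < E n).
{ intros n; apply Rmult_lt_0_compat; [apply Rmult_lt_0_compat; [lra|apply exp_pos]|].
  rewrite nome_pow; apply exp_pos. }
set (f := fun n x => (-1) ^ n * E n * sin ((2 * INR n + 1) * PI * x)).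
set (f' := fun n x => (-1) ^ n * E n * ((2 * INR n + 1) * PI * cos ((2 * INR n + 1) * PI * x))).
set (g := fun x => Series (fun n => f n x)).
assert (Hth : forall x : R, theta1 x s = RtoC (g x)).
{ intros x; rewrite theta1_real; f_equal; apply Series_ext; intros n; unfold f.
  now rewrite HE. }
assert (Hw : forall n, theta_weight 1 n = 2 * INR n + 1).
{ intros [|n]; cbn [theta_weight]; [simpl; ring|rewrite S_INR; simpl; ring]. }
destruct (theta_majorant s 0 1 Hs) as [M [HM HMn]].
assert (Hc : 0 < theta1_scale s) by (apply Rmult_lt_0_compat; [lra|apply exp_pos]).
assert (HP := PI_RGT_0).
assert (HEM : forall n, E n * (2 * INR n + 1) <= theta1_scale s * M n).
{ intros n; unfold E; rewrite Rmult_assoc; apply Rmult_le_compat_l; [lra|].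
  eapply Rle_trans; [|apply HMn].
  apply Rmult_le_compat_l; [rewrite nome_pow; left; apply exp_pos|].
  rewrite <- Hw; eapply Rle_trans; [apply Rle_abs|].
  apply Rabs_theta_weight_le; auto; lra. }
assert (Hg : is_derive g 0 (Series (fun n => f' n 0))).
{ apply (is_derive_Series f f' (fun n => PI * (theta1_scale s * M n)) 0 1); [lra| | | |].
  - apply (ex_series_scal_l (V := R_NormedModule)).
    now apply (ex_series_scal_l (V := R_NormedModule)).
  - intros n y _; unfold f, f'; auto_derive; [exact I|ring].
  - intros n y _; unfold f'.
    assert (Hn := pos_INR n).
    rewrite !Rabs_mult, pow_1_abs, Rmult_1_l, (Rabs_pos_eq (E n)) by (left; apply HE0).
    rewrite (Rabs_pos_eq PI), (Rabs_pos_eq (2 * INR n + 1)) by lra.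
    apply Rle_trans with (PI * (E n * (2 * INR n + 1)) * 1).
    + replace (E n * ((2 * INR n + 1) * PI * Rabs (cos ((2 * INR n + 1) * PI * y)))) with
        (PI * (E n * (2 * INR n + 1)) * Rabs (cos ((2 * INR n + 1) * PI * y))) by ring.
      apply Rmult_le_compat_l.
      * apply Rmult_le_pos; [lra|]; apply Rmult_le_pos; [left; apply HE0|lra].
      * apply Rabs_le, COS_bound.
    + rewrite Rmult_1_r; apply Rmult_le_compat_l; [lra|apply HEM].
  - intros y _; apply ex_series_dominated with (fun n => theta1_scale s * M n).
    + now apply (ex_series_scal_l (V := R_NormedModule)).
    + intros n; eapply Rle_trans; [|apply HEM]; unfold f.
      assert (Hn := pos_INR n).
      rewrite !Rabs_mult, pow_1_abs, Rmult_1_l, (Rabs_pos_eq (E n)) by (left; apply HE0).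
      apply Rmult_le_compat_l; [left; apply HE0|].
      apply Rle_trans with 1; [apply Rabs_le, SIN_bound|lra]. }
assert (Hval : Series (fun n => f' n 0) = PI * (theta1_scale s * theta_null 1 s)).
{ unfold theta_null; rewrite <- !Series_scal_l; apply Series_ext; intros n.
  unfold f', E; rewrite Rmult_0_r, cos_0, Hw; ring. }
assert (Hq : forall x : R, x <> 0 ->
  ((theta1 (x, 0) s - theta1 0 s) / ((x, 0) - 0))%C = RtoC ((g x - g 0) / x)).
{ intros x Hx; change (x, 0) with (RtoC x).
  rewrite !Hth, RtoC_div, RtoC_minus by exact Hx; f_equal; ring. }
assert (L1 : is_lim (fun x => fst ((theta1 (x, 0) s - theta1 0 s) / ((x, 0) - 0))%C) 0
               (PI * (theta1_scale s * theta_null 1 s))).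
{ apply is_lim_ext_loc with (fun x => (g x - g 0) / x).
  { exists (mkposreal 1 Rlt_0_1); intros x _ Hx; now rewrite Hq. }
  rewrite <- Hval; apply is_lim_spec; intros eps.
  destruct (proj1 (is_derive_Reals _ _ _) Hg eps (cond_pos eps)) as [d Hd].
  exists d; intros x Hx Hx0; change (Rabs (x - 0) < d) in Hx.
  rewrite Rminus_0_r in Hx; specialize (Hd x Hx0 Hx); now rewrite Rplus_0_l in Hd. }
assert (L2 : is_lim (fun x => snd ((theta1 (x, 0) s - theta1 0 s) / ((x, 0) - 0))%C) 0 0).
{ apply is_lim_ext_loc with (fun _ => 0); [|apply is_lim_const].
  exists (mkposreal 1 Rlt_0_1); intros x _ Hx; now rewrite Hq. }
unfold du, C_derive, C_lim; apply injective_projections.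
- exact (f_equal real (is_lim_unique _ _ _ L1)).
- exact (f_equal real (is_lim_unique _ _ _ L2)).
Qed.

Lemma theta3_shift (u : C) (s : R) : theta3 u s = theta4 (u + / 2) s.
Proof.
unfold theta3, theta4; do 2 f_equal; apply CSeries_ext; intros n.
assert (H : forall k, Ccos (RtoC (2 * INR k * PI) * (u + / 2))%C
  = (RtoC ((-1) ^ k) * Ccos (RtoC (2 * INR k * PI) * u))%C).
{ intros k.
  replace (RtoC (2 * INR k * PI) * (u + / 2))%C
    with (RtoC (2 * INR k * PI) * u + RtoC (INR k * PI))%C.
  2: { rewrite !RtoC_mult; field; apply C2_neq_0. }
  set (z := (RtoC (2 * INR k * PI) * u)%C); clearbody z.
  induction k as [|k IH]; [simpl (INR 0); rewrite Rmult_0_l, Cplus_0_r; simpl; ring|].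
  rewrite S_INR; replace (z + RtoC ((INR k + 1) * PI))%C with (z + RtoC (INR k * PI) + PI)%C.
  2: { rewrite !RtoC_mult, RtoC_plus; ring. }
  rewrite Ccos_plus_PI, IH, <- tech_pow_Rmult, (RtoC_mult (-1)); ring. }
rewrite H, Cmult_assoc, <- RtoC_mult; do 2 f_equal.
transitivity (((-1) ^ S n * (-1) ^ S n) * nome s ^ (S n ^ 2)); [|ring].
rewrite <- Rpow_mult_distr; replace (-1 * -1) with 1 by ring; rewrite pow1; ring.
Qed.

Lemma theta2_shift (u : C) (s : R) : theta2 u s = theta1 (u + / 2) s.
Proof.
unfold theta2, theta1; f_equal; apply CSeries_ext; intros n.
assert (H : forall k, Csin (RtoC ((2 * INR k + 1) * PI) * (u + / 2))%C
  = (RtoC ((-1) ^ k) * Ccos (RtoC ((2 * INR k + 1) * PI) * u))%C).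
{ intros k.
  replace (RtoC ((2 * INR k + 1) * PI) * (u + / 2))%C
    with (RtoC ((2 * INR k + 1) * PI) * u + PI / 2 + RtoC (INR k * PI))%C.
  2: { rewrite !RtoC_mult, !RtoC_plus, !RtoC_mult; field; apply C2_neq_0. }
  set (z := (RtoC ((2 * INR k + 1) * PI) * u)%C); clearbody z.
  induction k as [|k IH].
  - simpl (INR 0); rewrite Rmult_0_l, Cplus_0_r, Csin_plus_PI2; simpl; ring.
  - rewrite S_INR.
    replace (z + PI / 2 + RtoC ((INR k + 1) * PI))%C
      with (z + PI / 2 + RtoC (INR k * PI) + PI)%C.
    2: { rewrite !RtoC_mult, RtoC_plus; ring. }
    rewrite Csin_plus_PI, IH, <- tech_pow_Rmult, (RtoC_mult (-1)); ring. }
rewrite H, Cmult_assoc, <- RtoC_mult; do 2 f_equal.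
transitivity (((-1) ^ n * (-1) ^ n) * Rpower (nome s) ((INR n + 1 / 2) ^ 2)); [|ring].
rewrite <- Rpow_mult_distr; replace (-1 * -1) with 1 by ring; rewrite pow1; ring.
Qed.

(** * The expansions *)

Lemma theta4_expansion (t : R) (ht : 0 < t) (u : C) (F : R -> C) :
  Rabs (Im u) < 1 / 2 * PI * t ->
  (forall s, F s = theta4 u s) ->
  two_expansions (- (CDerive F t / F t) + dt theta4 0 t / theta4 0 t)%C
    (fun k =>
      (RtoC (PI ^ 2 * (2 * INR k + 1) * coth ((INR k + 1 / 2) * PI ^ 2 * t))
         * Csin (PI * u) ^ 2
       / (RtoC (sinh ((INR k + 1 / 2) * PI ^ 2 * t) ^ 2) + Csin (PI * u) ^ 2))%C)
    (fun k =>
      (RtoC (PI ^ 2 * (2 * INR k + 1) * coth ((INR k + 1 / 2) * PI ^ 2 * t))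
         * Csin (PI * u) ^ 2
       / (RtoC (cosh ((2 * INR k + 1) * PI ^ 2 * t)) - Ccos (2 * PI * u)))%C).
Proof.
intros Hu HF; assert (HP := PI_RGT_0).
assert (Hstrip : PI * Rabs (Im u) < rate 0 0 * t).
{ replace (rate 0 0 * t) with (PI * (1 / 2 * PI * t)) by (unfold rate; simpl; field).
  now apply Rmult_lt_compat_l. }
assert (H2 : forall k, 2 * rate 0 k = PI ^ 2 * (2 * INR k + 1))
  by (intros k; unfold rate; simpl (INR 0); field).
assert (H1 : forall k, rate 0 k * t = (INR k + 1 / 2) * PI ^ 2 * t)
  by (intros k; unfold rate; simpl (INR 0); field).
assert (H3 : forall k, 2 * (rate 0 k * t) = (2 * INR k + 1) * PI ^ 2 * t)
  by (intros k; unfold rate; simpl (INR 0); field).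
eapply two_expansions_ext; [| |apply (two_expansions_product 0 t u ht Hstrip F
  (fun s => theta4 0 s) 1 1 (theta_null 0))].
- intros k; cbv beta; now rewrite H2, H1.
- intros k; cbv beta; now rewrite H2, H3, H1.
- intros s Hs; rewrite HF; now apply theta4_product.
- intros s Hs; rewrite Rmult_1_l; now apply theta4_0.
- apply ex_derive_theta_null; auto.
- apply C1_nz.
- lra.
- now apply theta_null_0_neq_0.
Qed.

Lemma theta1_expansion (t : R) (ht : 0 < t) (u : C) (F : R -> C) :
  Rabs (Im u) < PI * t ->
  (forall s, F s = theta1 u s) -> F t <> 0%C ->
  two_expansions (- (CDerive F t / F t) + dt (du theta1) 0 t / du theta1 0 t)%C
    (fun j => let k := S j in
      (RtoC (2 * INR k * PI ^ 2 * coth (INR k * PI ^ 2 * t)) * Csin (PI * u) ^ 2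
       / (RtoC (sinh (INR k * PI ^ 2 * t) ^ 2) + Csin (PI * u) ^ 2))%C)
    (fun j => let k := S j in
      (RtoC (2 * INR k * PI ^ 2 * coth (INR k * PI ^ 2 * t)) * Csin (PI * u) ^ 2
       / (RtoC (cosh (2 * INR k * PI ^ 2 * t)) - Ccos (2 * PI * u)))%C).
Proof.
intros Hu HF HF0; assert (HP := PI_RGT_0).
assert (Hstrip : PI * Rabs (Im u) < rate 1 0 * t).
{ replace (rate 1 0 * t) with (PI * (PI * t)) by (unfold rate; simpl; field).
  now apply Rmult_lt_compat_l. }
assert (H1 : forall k, rate 1 k = INR (S k) * PI ^ 2)
  by (intros k; unfold rate; rewrite (S_INR k); change (INR 1) with 1; field).
assert (H2 : forall k, 2 * rate 1 k = 2 * INR (S k) * PI ^ 2)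
  by (intros k; rewrite H1; ring).
assert (H3 : forall k, 2 * (rate 1 k * t) = 2 * INR (S k) * PI ^ 2 * t)
  by (intros k; rewrite H1; ring).
rewrite HF, theta1_product in HF0 by exact ht.
assert (Hsin : Csin (PI * u) <> 0%C) by (intros E; apply HF0; rewrite E; ring).
assert (Hnull : theta1_scale t * theta_null 1 t <> 0)
  by (intros E; apply HF0; rewrite E; ring).
eapply two_expansions_ext; [| |apply (two_expansions_product 1 t u ht Hstrip F
  (fun s => du theta1 0 s) (Csin (PI * u)) PI (fun s => theta1_scale s * theta_null 1 s))].
- intros k; cbv beta zeta; now rewrite H2, H1.
- intros k; cbv beta zeta; now rewrite H2, H3, H1.
- intros s Hs; rewrite HF; now apply theta1_product.
- intros s Hs; now apply du_theta1_0.
- apply (ex_derive_mult theta1_scale (theta_null 1)).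
  + unfold theta1_scale; auto_derive; exact I.
  + apply ex_derive_theta_null; auto.
- exact Hsin.
- lra.
- exact Hnull.
Qed.

Lemma im_plus_half (u : C) : Im (u + / 2)%C = Im u.
Proof. rewrite <- RtoC_inv by lra; simpl; unfold Im; ring. Qed.

Lemma Csin_half_period (u : C) : Csin (PI * (u + / 2)) = Ccos (PI * u).
Proof.
rewrite <- Csin_plus_PI2; f_equal; field; apply C2_neq_0.
Qed.

Lemma Ccos_half_period (u : C) : Ccos (2 * PI * (u + / 2)) = (- Ccos (2 * PI * u))%C.
Proof.
rewrite <- Ccos_plus_PI; f_equal; field; apply C2_neq_0.
Qed.

Theorem theorem1 (t : R) (ht : 0 < t) (u : C) :
  (Rabs (Im u) < 1 / 2 * PI * t ->
    two_expansions
      (- (dt theta3 u t / theta3 u t) + dt theta4 0 t / theta4 0 t)%C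
      (fun k =>
        (RtoC (PI ^ 2 * (2 * INR k + 1) * coth ((INR k + 1 / 2) * PI ^ 2 * t))
           * Ccos (PI * u) ^ 2
         / (RtoC (sinh ((INR k + 1 / 2) * PI ^ 2 * t) ^ 2) + Ccos (PI * u) ^ 2))%C)
      (fun k =>
        (RtoC (PI ^ 2 * (2 * INR k + 1) * coth ((INR k + 1 / 2) * PI ^ 2 * t))
           * Ccos (PI * u) ^ 2
         / (RtoC (cosh ((2 * INR k + 1) * PI ^ 2 * t)) + Ccos (2 * PI * u)))%C)
    /\
    two_expansions
      (- (dt theta4 u t / theta4 u t) + dt theta4 0 t / theta4 0 t)%C
      (fun k =>
        (RtoC (PI ^ 2 * (2 * INR k + 1) * coth ((INR k + 1 / 2) * PI ^ 2 * t))
           * Csin (PI * u) ^ 2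
         / (RtoC (sinh ((INR k + 1 / 2) * PI ^ 2 * t) ^ 2) + Csin (PI * u) ^ 2))%C)
      (fun k =>
        (RtoC (PI ^ 2 * (2 * INR k + 1) * coth ((INR k + 1 / 2) * PI ^ 2 * t))
           * Csin (PI * u) ^ 2
         / (RtoC (cosh ((2 * INR k + 1) * PI ^ 2 * t)) - Ccos (2 * PI * u)))%C))
  /\
  (Rabs (Im u) < PI * t ->
    (theta1 u t <> 0%C ->
     two_expansions
      (- (dt theta1 u t / theta1 u t) + dt (du theta1) 0 t / du theta1 0 t)%C
      (fun j => let k := S j in
        (RtoC (2 * INR k * PI ^ 2 * coth (INR k * PI ^ 2 * t)) * Csin (PI * u) ^ 2
         / (RtoC (sinh (INR k * PI ^ 2 * t) ^ 2) + Csin (PI * u) ^ 2))%C)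
      (fun j => let k := S j in
        (RtoC (2 * INR k * PI ^ 2 * coth (INR k * PI ^ 2 * t)) * Csin (PI * u) ^ 2
         / (RtoC (cosh (2 * INR k * PI ^ 2 * t)) - Ccos (2 * PI * u)))%C))
    /\
    (theta2 u t <> 0%C ->
     two_expansions
      (- (dt theta2 u t / theta2 u t) + dt (du theta1) 0 t / du theta1 0 t)%C
      (fun j => let k := S j in
        (RtoC (2 * INR k * PI ^ 2 * coth (INR k * PI ^ 2 * t)) * Ccos (PI * u) ^ 2
         / (RtoC (sinh (INR k * PI ^ 2 * t) ^ 2) + Ccos (PI * u) ^ 2))%C)
      (fun j => let k := S j in
        (RtoC (2 * INR k * PI ^ 2 * coth (INR k * PI ^ 2 * t)) * Ccos (PI * u) ^ 2
         / (RtoC (cosh (2 * INR k * PI ^ 2 * t)) + Ccos (2 * PI * u)))%C))).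
Proof.
split; intros Hu; split.
- eapply two_expansions_ext;
    [| |apply (theta4_expansion t ht (u + / 2)%C (fun s => theta3 u s))].
  + intros k; cbv beta; now rewrite Csin_half_period.
  + intros k; cbv beta; rewrite Csin_half_period, Ccos_half_period; unfold Cminus.
    do 2 f_equal; ring.
  + now rewrite im_plus_half.
  + intros s; apply theta3_shift.
- now apply (theta4_expansion t ht u (fun s => theta4 u s)).
- intros H0; now apply (theta1_expansion t ht u (fun s => theta1 u s)).
- intros H0; eapply two_expansions_ext;
    [| |apply (theta1_expansion t ht (u + / 2)%C (fun s => theta2 u s))].
  + intros k; cbv beta zeta; now rewrite Csin_half_period.
  + intros k; cbv beta zeta; rewrite Csin_half_period, Ccos_half_period; unfold Cminus.
    do 2 f_equal; ring.
  + now rewrite im_plus_half.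
  + intros s; apply theta2_shift.
  + exact H0.
Qed.
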